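(* For any 1-cycle $\sigma$ of $\mathbf C^n$ and for a form $\phi\in\mathfrak C^{1,4}(\mathbb T_2)$, we have $$\mathcal A_n(\langle\sigma,\phi\rangle)=\int_\sigma\mathfrak L^\uparrow\phi+O(\epsilon_n\|\sigma\|_F),$$ where $\mathcal A_n(\langle\sigma,\phi\rangle)$ denotes $\mathcal A_n$ applied to the function $\langle\cdot,\phi\rangle$ and evaluated at $\sigma$, and $\|\cdot\|_F$ is the flat norm.
   Context: $\mathbb T_2$ is the flat torus $[0,2]\times[0,\sqrt3]$ with opposite edges identified. Put $\epsilon_n=1/n$ and $V_n=\{(2k\epsilon_n,2l\sqrt3\epsilon_n):0\le k<n,0\le2l<n\}\cup\{((2k+1)\epsilon_n,(2l+1)\sqrt3\epsilon_n):0<2k+1\le2n,0<2l+1\le n\}$. Let $\mathcal T_n$ be the regular triangulation of $\mathbb T_2$ with vertices $V_n$ and edge length $2\epsilon_n$, and $\mathbf C^n$ the simplicial complex of its triangles, edges and vertices. $\mathcal S_2^n$ is the set of oriented triangles (both orientations) and $\mathcal C_1^n$ the space of real 1-chains, with the inner product for which the positively oriented edges form an orthonormal basis. The boundary is $\partial_2[u,v,w]=[v,w]-[u,w]+[u,v]$ and $\partial_1[u,v]=v-u$; a 1-cycle is a 1-chain $\sigma$ with $\partial_1\sigma=0$. Put $w(\sigma,\partial_2\tau)=\max(\langle\partial_2\tau,\sigma\rangle,0)$ (chain inner product). The generator is $\mathcal A_nF(\sigma)=\epsilon_n^{-2}\sum_{\tau\in\mathcal S_2^n}(F(\sigma-\partial_2\tau)-F(\sigma))w(\sigma,\partial_2\tau)$.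 $\mathfrak C^1$ is the space of continuous 1-forms $\phi=\phi^1dx_1+\phi^2dx_2$ on $\mathbb T_2$, with norm $\|\phi\|_{\mathfrak C^1}=\|\phi^1\|_\infty+\|\phi^2\|_\infty$, and $\mathfrak C_1$ is its dual with dual norm. $\mathfrak C^{1,4}$ is the space of 1-forms with coefficients of class $\mathcal C^4$. A 1-chain is viewed as a current by $\langle\sigma,\phi\rangle=\int_\sigma\phi$. $\mathfrak C_2$ is the dual of the space of continuous 2-forms with sup norm, and $\partial_2$ on $\mathfrak C_2$ is dual to the exterior derivative. The flat norm is $\|X\|_F=\inf_{\Delta\in\mathfrak C_2}\|X-\partial_2\Delta\|_{\mathfrak C_1}+\|\Delta\|_{\mathfrak C_2}$. The operator $\mathfrak L^\uparrow=*\mathrm d*\mathrm d$ ($*$ the Hodge transform) is $\mathfrak L^\uparrow\phi=(\phi^1_{22}-\phi^2_{12})dx_1+(\phi^2_{11}-\phi^1_{12})dx_2$, subscripts denoting partial derivatives. The $O(\cdot)$ is as $n\to\infty$, with a constant depending on $\phi$ but not on $\sigma$ or $n$.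
   Formalization: n is restricted to even values: for odd n the row 2l+1=n of V_n falls on row 0 of the torus shifted by ε_n, so no regular triangulation T_n with vertices V_n and edge length 2ε_n exists. *)

(* Defs.v *)
From HB Require Import structures.
From mathcomp Require Import all_boot all_order all_algebra.
From mathcomp Require Import all_classical all_reals all_analysis.
From mathcomp Require Import zify ring lra.
Set Implicit Arguments.
Unset Strict Implicit.
Unset Printing Implicit Defensive.
Import Order.TTheory GRing.Theory Num.Theory.
Import numFieldNormedType.Exports.
Local Open Scope classical_set_scope.
Local Open Scope ring_scope.

Definition epsn (R : realType) (n : nat) : R := n%:R^-1.

(* The index (i, j) stands for the i-th vertex on the horizontal line of height
   j * sqrt 3 * epsn. For even n these are exactly the points of [vertex_set]
   (see [range_vpos]); for odd n the rows do not close up around the torus and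
   there is no regular triangulation with these vertices. *)
Definition vertex (n : nat) := ('I_n * 'I_n)%type.

Definition vpos (R : realType) (n : nat) (v : vertex n) : R * R :=
  ((2 * v.1 + odd v.2)%:R * epsn R n, v.2%:R * Num.sqrt 3 * epsn R n).

Definition vertex_set (R : realType) (n : nat) : set (R * R) :=
  [set p | exists k l : nat, [/\ (k < n)%N, (2 * l < n)%N &
     p = ((2 * k)%:R * epsn R n, (2 * l)%:R * Num.sqrt 3 * epsn R n)]] `|`
  [set p | exists k l : nat,
     [/\ (0 < 2 * k + 1 <= 2 * n)%N, (0 < 2 * l + 1 <= n)%N &
     p = ((2 * k + 1)%:R * epsn R n, (2 * l + 1)%:R * Num.sqrt 3 * epsn R n)]].

(* The neighbour of v in direction 0, pi/3 (k = 1) or 2pi/3 (k = 2). *)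
Definition nbr (n : nat) (v : vertex n) (k : 'I_3) : vertex n :=
  match val k with
  | 0 => (ordS v.1, v.2)
  | 1 => (if odd v.2 then ordS v.1 else v.1, ordS v.2)
  | _ => (if odd v.2 then v.1 else ord_pred v.1, ordS v.2)
  end.

Definition edge_vec (R : realType) (n : nat) (k : 'I_3) : R * R :=
  match val k with
  | 0 => (2 * epsn R n, 0)
  | 1 => (epsn R n, Num.sqrt 3 * epsn R n)
  | _ => (- epsn R n, Num.sqrt 3 * epsn R n)
  end.

(* The positively oriented edge (v, k) goes from v to nbr v k. *)
Definition edge (n : nat) := (vertex n * 'I_3)%type.
Definition src (n : nat) (e : edge n) : vertex n := e.1.
Definition tgt (n : nat) (e : edge n) : vertex n := nbr e.1 e.2.

Definition chain1 (R : realType) (n : nat) := {ffun edge n -> R}.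
Definition chain0 (R : realType) (n : nat) := {ffun vertex n -> R}.

Definition chain_dot (R : realType) (n : nat) (s t : chain1 R n) : R :=
  \sum_(e : edge n) s e * t e.

Definition vertex_chain (R : realType) (n : nat) (v : vertex n) : chain0 R n :=
  [ffun x => (x == v)%:R].

(* [u, v] as a 1-chain: plus the positively oriented edge from u to v, or minus
   the one from v to u. *)
Definition edge_chain (R : realType) (n : nat) (u v : vertex n) : chain1 R n :=
  [ffun e => ((src e == u) && (tgt e == v))%:R
             - ((src e == v) && (tgt e == u))%:R].

Definition bd1 (R : realType) (n : nat) (s : chain1 R n) : chain0 R n :=
  \sum_(e : edge n) s e *: (vertex_chain R (tgt e) - vertex_chain R (src e)).

Definition cycle1 (R : realType) (n : nat) (s : chain1 R n) : Prop := bd1 s = 0.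

(* (v, true) is the upward triangle whose lower left vertex is v, (v, false) the
   downward triangle whose lowest vertex is v; an oriented triangle carries one
   more boolean, true meaning counterclockwise. *)
Definition triangle (n : nat) := (vertex n * bool)%type.
Definition otriangle (n : nat) := (triangle n * bool)%type.

Definition otriangle_vertices (n : nat) (t : otriangle n) :
    vertex n * vertex n * vertex n :=
  let: (u, up, ccw) := t in
  let k : 'I_3 := inord (if up then 0 else 1) in
  let k' : 'I_3 := inord (if up then 1 else 2) in
  if ccw then (u, nbr u k, nbr u k') else (u, nbr u k', nbr u k).

Definition bd2 (R : realType) (n : nat) (t : otriangle n) : chain1 R n :=
  let: (u, v, w) := otriangle_vertices t in
  edge_chain R v w - edge_chain R u w + edge_chain R u v.

Definition jump_rate (R : realType) (n : nat) (s b : chain1 R n) : R :=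
  Num.max (chain_dot b s) 0.

Definition generator (R : realType) (n : nat) (F : chain1 R n -> R)
    (s : chain1 R n) : R :=
  (epsn R n) ^- 2 *
  \sum_(t : otriangle n) (F (s - bd2 R t) - F s) * jump_rate s (bd2 R t).

(* Functions on the torus are doubly periodic functions on the plane; a 1-form is
   the pair of its coefficients on dx1, dx2, a 2-form its coefficient on
   dx1 /\ dx2. *)
Definition periodic (R : realType) (f : R * R -> R) : Prop :=
  forall p : R * R,
    f (p.1 + 2, p.2) = f p /\ f (p.1, p.2 + Num.sqrt 3) = f p.

Definition d1 (R : realType) (f : R * R -> R) : R * R -> R :=
  'D_((1, 0) : R * R) f.
Definition d2 (R : realType) (f : R * R -> R) : R * R -> R :=
  'D_((0, 1) : R * R) f.

Fixpoint class_C (R : realType) (k : nat) (f : R * R -> R) : Prop :=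
  continuous f /\
  match k with
  | 0 => True
  | k'.+1 => [/\ forall p, derivable f p (1, 0), forall p, derivable f p (0, 1),
                class_C k' (d1 f) & class_C k' (d2 f)]
  end.

Definition form1 (R : realType) := ((R * R -> R) * (R * R -> R))%type.
Definition form2 (R : realType) := (R * R -> R).

Definition form1_C (R : realType) (k : nat) : set (form1 R) :=
  [set phi | [/\ periodic phi.1, periodic phi.2,
                 class_C k phi.1 & class_C k phi.2]].
Definition form2_C (R : realType) (k : nat) : set (form2 R) :=
  [set w | periodic w /\ class_C k w].

Definition sup_norm (R : realType) (f : R * R -> R) : R :=
  sup (range (fun p => `|f p|)).
Definition norm1 (R : realType) (phi : form1 R) : R :=
  sup_norm phi.1 + sup_norm phi.2.
Definition norm2 (R : realType) (w : form2 R) : R := sup_norm w.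

Definition ext_d0 (R : realType) (f : R * R -> R) : form1 R := (d1 f, d2 f).
Definition ext_d1 (R : realType) (phi : form1 R) : form2 R :=
  fun p => d1 phi.2 p - d2 phi.1 p.
(* *dx1 = dx2, *dx2 = - dx1, *(dx1 /\ dx2) = 1 *)
Definition hodge1 (R : realType) (phi : form1 R) : form1 R :=
  (fun p => - phi.2 p, phi.1).
Definition hodge2 (R : realType) (w : form2 R) : R * R -> R := w.

Definition Lup (R : realType) (phi : form1 R) : form1 R :=
  hodge1 (ext_d0 (hodge2 (ext_d1 phi))).

(* The dual of the space D normed by N: a functional is a function on all of V of
   which only the values on D matter. *)
Definition in_dual (R : realType) (V : lmodType R) (D : set V) (N : V -> R)
    (X : V -> R) : Prop :=
  (forall (a : R) (u v : V), D u -> D v -> X (a *: u + v) = a * X u + X v) /\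
  (exists M : R, forall u, D u -> `|X u| <= M * N u).

Definition dual_norm (R : realType) (V : lmodType R) (D : set V) (N : V -> R)
    (X : V -> R) : R :=
  sup [set `|X u| | u in [set u | D u /\ N u <= 1]].

Definition current1 (R : realType) (X : form1 R -> R) : Prop :=
  in_dual (@form1_C R 0) (@norm1 R) X.
Definition current2 (R : realType) (Delta : form2 R -> R) : Prop :=
  in_dual (@form2_C R 0) (@norm2 R) Delta.
Definition current1_norm (R : realType) (X : form1 R -> R) : R :=
  dual_norm (@form1_C R 0) (@norm1 R) X.
Definition current2_norm (R : realType) (Delta : form2 R -> R) : R :=
  dual_norm (@form2_C R 0) (@norm2 R) Delta.

(* [bd_current2 Delta] is only meaningful on C^1 forms and need not extend to
   continuous ones. *)
Definition bd_current2 (R : realType) (Delta : form2 R -> R) : form1 R -> R :=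
  fun phi => Delta (ext_d1 phi).

(* The infimum runs over the Delta such that X - bd_current2 Delta has a (by
   density unique) continuous extension Y to the continuous 1-forms; for the other
   Delta the first norm is infinite. *)
Definition flat_norm (R : realType) (X : form1 R -> R) : R :=
  inf [set r : R | exists (Delta : form2 R -> R) (Y : form1 R -> R),
    [/\ current2 Delta, current1 Y,
        forall phi, form1_C 1 phi -> Y phi = X phi - bd_current2 Delta phi &
        r = current1_norm Y + current2_norm Delta]].

Definition edge_integral (R : realType) (n : nat) (e : edge n) (phi : form1 R) : R :=
  let p := vpos R (src e) in
  let h := edge_vec R n e.2 in
  \int[lebesgue_measure]_(t in `[0, 1])
    (phi.1 (p + t *: h) * h.1 + phi.2 (p + t *: h) * h.2).

Definition pairing (R : realType) (n : nat) (s : chain1 R n) (phi : form1 R) : R :=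
  \sum_(e : edge n) s e * edge_integral e phi.

Lemma LupE (R : realType) (phi : form1 R) : form1_C 2 phi ->
  Lup phi = (fun p => d2 (d2 phi.1) p - d2 (d1 phi.2) p,
             fun p => d1 (d1 phi.2) p - d1 (d2 phi.1) p).
Proof.
case=> _ _ [_ [_ _ _ [_ [h1 h2 _ _]]]] [_ [_ _ [_ [h3 h4 _ _]] _]].
have dE : ext_d1 phi = d1 phi.2 - d2 phi.1 by [].
rewrite /Lup /hodge1 /ext_d0 /hodge2 /= dE.
by congr pair; apply/funext => p; rewrite /d1 /d2 deriveB ?opprB.
Qed.

Lemma range_vpos (R : realType) (n : nat) : ~~ odd n ->
  range (@vpos R n) = @vertex_set R n.
Proof.
move=> en; apply/seteqP; split=> p.
  move=> [[i j] _ <-]; rewrite /vpos /=; have := ltn_ord i; have := ltn_ord j.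
  have := odd_double_half j; rewrite -muln2 mulnC.
  case: (odd j) => /= hj jn hi; [right|left]; exists (i : nat), (j./2 : nat).
    by split; [lia|lia|rewrite -[in LHS]hj (addnC 1)%N].
  by split; [lia|lia|rewrite -[in LHS]hj addn0].
case=> -[k [l [hk hl ->]]].
  exists (Ordinal hk, Ordinal hl) => //=; rewrite /vpos /=.
  by rewrite (_ : odd (2 * l) = false) ?addn0 //; lia.
have hk' : (k < n)%N by lia.
have hl' : (2 * l + 1 < n)%N by lia.
exists (Ordinal hk', Ordinal hl') => //=; rewrite /vpos /=.
by rewrite (_ : odd (2 * l + 1) = true) //; lia.
Qed.

Lemma vpos_inj (R : realType) (n : nat) : injective (@vpos R n).
Proof.
move=> [i j] [i' j'] [] /=; have n0 : (0 < n)%N by have := ltn_ord i; lia.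
have e0 : epsn R n != 0 by rewrite invr_eq0 pnatr_eq0 -lt0n.
have s0 : Num.sqrt 3 != 0 :> R by rewrite gt_eqF ?sqrtr_gt0.
move=> /(mulIf e0) /eqP; rewrite eqr_nat => /eqP h1.
move=> /(mulIf e0) /(mulIf s0) /eqP; rewrite eqr_nat => /eqP h2.
by congr pair; apply/val_inj => //=; lia.
Qed.

Lemma vpos_tgt (R : realType) (n : nat) (e : edge n) : ~~ odd n ->
  exists a b : int,
    vpos R (src e) + edge_vec R n e.2 =
    vpos R (tgt e) + (a%:~R * 2, b%:~R * Num.sqrt 3).
Proof.
case: e => -[i j] k en; rewrite /src /tgt /=.
have hi := ltn_ord i; have hj := ltn_ord j.
have ne : n%:R * epsn R n = 1 by rewrite mulfV // pnatr_eq0; lia.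
have key (x y x' y' : nat) (dx dy a b : int) (h1 h2 : R) :
    x%:Z + dx = x'%:Z + a * (2 * n%:Z) -> y%:Z + dy = y'%:Z + b * n%:Z ->
    h1 = dx%:~R * epsn R n -> h2 = dy%:~R * (Num.sqrt 3 * epsn R n) ->
    (x%:R * epsn R n, y%:R * Num.sqrt 3 * epsn R n) + (h1, h2) =
    (x'%:R * epsn R n, y'%:R * Num.sqrt 3 * epsn R n)
      + (a%:~R * 2, b%:~R * Num.sqrt 3) :> R * R.
  move=> /(congr1 (intr : int -> R)) + /(congr1 (intr : int -> R)).
  rewrite !intrD !intrM -!pmulrn => hx hy -> ->; congr pair => /=.
    by rewrite -mulrDl hx mulrDl -!mulrA ne mulr1.
  by rewrite -mulrA -mulrDl hy mulrDl -!mulrA [n%:R * _]mulrCA ne mulr1.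
have val_ordS (x : 'I_n) : exists a : int, (ordS x)%:Z + a * n%:Z = x%:Z + 1.
  rewrite /=; have hx := ltn_ord x.
  case: (ltnP x.+1 n) => h; first by exists 0; rewrite modn_small //; lia.
  by exists 1; rewrite (_ : x.+1 = n) ?modnn; lia.
have val_pred (x : 'I_n) : exists a : int, (ord_pred x)%:Z + a * n%:Z = x%:Z - 1.
  have [a ha] := val_ordS (ord_pred x); exists (- a).
  by rewrite ord_predK in ha; lia.
have odd_ordS : odd (ordS j) = ~~ odd j.
  rewrite /=; case: (ltnP j.+1 n) => h; first by rewrite modn_small.
  by rewrite (_ : j.+1 = n) ?modnn; lia.
have [b hb] := val_ordS j; have [a ha] := val_ordS i; have [c hc] := val_pred i.
rewrite /vpos /edge_vec /nbr /= {val_ordS val_pred}.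
move: (ordS i) (ordS j) (ord_pred i) ha hb hc odd_ordS => i' j' i'' ha hb hc oj.
case: k => -[|[|[|//]]] hk /=.
- by exists a, 0; apply: (key _ _ _ _ 2 0); rewrite ?mul0r //; lia.
- exists (if odd j then a else 0), b.
  apply: (key _ _ _ _ 1 1); rewrite ?mul1r // oj.
  by case: (odd j); lia.
- exists (if odd j then 0 else c), b.
  apply: (key _ _ _ _ (-1) 1); rewrite ?mulrN1z ?mulN1r ?mul1r // oj.
  by case: (odd j); lia.
Qed.

(* Main.v *)
(* On a 1-chain the two orientations of a triangle combine into the linear
   expression [A_n <sigma, phi> = - eps^-2 \sum_tau <bd tau, phi> <bd tau, sigma>].
   Its coefficient on an edge is the difference of the integrals of [phi] over the
   boundaries of the two adjacent triangles.  Both triangles are exchanged by the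
   symmetry about the midpoint of the edge, so a Taylor expansion at that point
   shows that this coefficient is the integral of [Lup phi] over the edge, up to an
   error [r] of order [eps^3].
   The flat norm is then brought in by duality: spreading the numbers [r] with bumps
   supported away from the other edges produces a C^1 form [psi] with
   [\int_e psi = r e] for every edge, [psi = O(eps^2)] and [d psi = O(eps)], and
   [|<sigma, psi>| <= max(|psi|, |d psi|) * |sigma|_F] up to a constant. *)

From HB Require Import structures.
From mathcomp Require Import all_boot all_order all_algebra.
From mathcomp Require Import all_classical all_reals all_analysis.
From mathcomp Require Import zify ring lra.
Require Import Defs.
Set Implicit Arguments.
Unset Strict Implicit.
Unset Printing Implicit Defensive.
Import Order.TTheory GRing.Theory Num.Theory.
Import numFieldNormedType.Exports.
Local Open Scope classical_set_scope.
Local Open Scope ring_scope.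

(** * Integration over [[0, 1]] *)

(** Bounding the error edge by edge would leave eps^2 times the mass of [sigma], and mass is not
    controlled by the flat norm uniformly in n: the boundary of one triangle has mass of order eps,
    but flat norm at most of order eps^2. What does hold is an inverse estimate on the mesh, mass <=
    C eps^-1 flat norm, and [psi] carries it by duality. Dividing by the edge length makes [psi] of
    order r / eps, and each derivative costs another eps^-1, so it is d psi, of order r / eps^2,
    that fixes the rate eps. Only the size of [r] enters, not its regularity from edge to edge. The
    exponent 3 is what four derivatives of [phi] give: a cubic Taylor remainder eps^4, times the
    edge length eps, divided by the eps^2 of the generator. The form must be C^1 because boundaries
    of 2-currents are evaluated on C^1 forms only. Whitney forms would have the right integrals but
    jump across edges; this is why bumps are used. *)

Definition int01 (R : realType) (f : R -> R) : R :=
  \int[lebesgue_measure]_(t in `[0, 1]) f t.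

Lemma integrable01 (R : realType) (f : R -> R) : continuous f ->
  lebesgue_measure.-integrable `[0 : R, 1] (EFin \o f).
Proof.
move=> cf; apply: continuous_compact_integrable; first exact: segment_compact.
exact: continuous_subspaceT.
Qed.

Lemma int01_lin (R : realType) (a : R) (f g : R -> R) :
  continuous f -> continuous g ->
  int01 (fun t => a * f t + g t) = a * int01 f + int01 g.
Proof.
move=> cf cg; rewrite /int01 RintegralD ?RintegralZl //; last 2 first.
- apply: (@integrable01 _ (fun t => a * f t)) => t.
  by apply: cvgM; [exact: cvg_cst|exact: cf].
- exact: integrable01.
- exact: integrable01.
Qed.

Lemma int01_bound (R : realType) (M : R) (f : R -> R) : continuous f ->
  (forall t, 0 <= t <= 1 -> `|f t| <= M) -> `|int01 f| <= M.
Proof.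
move=> cf fM; apply: le_trans (le_normr_Rintegral _ _) _ => //.
  exact: integrable01.
have -> : M = int01 (fun=> M).
  by rewrite /int01 Rintegral_cst //= lebesgue_measure_itv /= lte01 sube0 mulr1.
apply: le_Rintegral => //.
- by apply: (@integrable01 _ (fun t => `|f t|)) => t; apply: cvg_norm; exact: cf.
- by apply: (@integrable01 _ (fun=> M)) => t; exact: cvg_cst.
Qed.

Lemma int01_deriv (R : realType) (p : {poly R}) :
  int01 (horner p^`()) = p.[1] - p.[0].
Proof.
rewrite /int01 /Rintegral (@continuous_FTC2 _ _ (horner p)) //.
- by apply: continuous_subspaceT; exact: continuous_horner.
- split.
  + by move=> x _; exact: derivable_horner.
  + by apply: cvg_at_right_filter; exact: continuous_horner.
  + by apply: cvg_at_left_filter; exact: continuous_horner.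
- by move=> x _; rewrite derivE.
Qed.

Lemma int01_simpson (R : realType) (c0 c1 c2 c3 : R) :
  let q t := c0 + c1 * t + c2 * t ^+ 2 + c3 * t ^+ 3 in
  int01 q = (q 0 + 4 * q 2^-1 + q 1) / 6.
Proof.
move=> q.
pose p : {poly R} := c0 *: 'X + (c1 / 2) *: 'X^2 + (c2 / 3) *: 'X^3
  + (c3 / 4) *: 'X^4.
have qE : q = horner p^`().
  apply/funext => t; rewrite /p /q !(derivD, derivZ, derivX, derivXn).
  by rewrite !(hornerD, hornerZ, hornerMn, hornerXn, hornerC) /=; field.
rewrite [in LHS]qE int01_deriv /p.
by rewrite !(hornerD, hornerZ, hornerXn, hornerX) /q; field.
Qed.

(** This is the Beta value B(5,5) = 4! 4! / 9!. Its inverse 630 is the normalising constant of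
    [edge_form]. *)
Lemma int01_bump (R : realType) :
  int01 (fun t : R => ((t * (1 - t)) ^+ 2) ^+ 2) = 630^-1.
Proof.
pose p : {poly R} := 5^-1 *: 'X^5 - (2 / 3) *: 'X^6 + (6 / 7) *: 'X^7
  - 2^-1 *: 'X^8 + 9^-1 *: 'X^9.
have -> : (fun t : R => ((t * (1 - t)) ^+ 2) ^+ 2) = horner p^`().
  apply/funext => t; rewrite /p !(derivB, derivD, derivZ, derivXn).
  by rewrite !(hornerD, hornerN, hornerZ, hornerMn, hornerXn) /=; field.
rewrite int01_deriv /p.
by rewrite !(hornerD, hornerN, hornerZ, hornerXn, hornerX); field.
Qed.

(** * Periodic functions and integrals over segments *)

Lemma periodicZ (R : realType) (f : R * R -> R) (p : R * R) (a b : int) :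
  periodic f -> f (p + (a%:~R * 2, b%:~R * Num.sqrt 3)) = f p.
Proof.
move=> pf.
have step (g : R -> R) (c : R) : (forall x, g (x + c) = g x) ->
    forall (m : int) x, g (x + m%:~R * c) = g x.
  move=> gc; have gn (m : nat) x : g (x + m%:R * c) = g x.
    elim: m => [|m IH]; first by rewrite mul0r addr0.
    by rewrite -natr1 mulrDl mul1r addrA gc IH.
  case=> m x; first exact: gn.
  by rewrite NegzE -(gn m.+1) mulrNz mulNr addrNK.
case: p => x y /=.
rewrite (step (fun t => f (t, y + b%:~R * Num.sqrt 3)) 2).
  by rewrite (step (fun t => f (x, t)) (Num.sqrt 3)) // => t; case: (pf (x, t)).
by move=> t; case: (pf (t, y + b%:~R * Num.sqrt 3)).
Qed.

Lemma periodic_bounded (R : realType) (f : R * R -> R) :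
  periodic f -> continuous f ->
  exists2 M : R, 0 <= M & forall p, `|f p| <= M.
Proof.
move=> pf cf.
pose K : set (R * R) := `[0, 2] `*` `[0, Num.sqrt 3].
have cK : compact K by apply: compact_setX; exact: segment_compact.
have s0 : 0 < Num.sqrt 3 :> R by rewrite sqrtr_gt0.
have K0 : K (0, 0) by split; rewrite /= in_itv /= lexx ?ler0n ?ltW.
have cnf : {within K, continuous (fun p => `|f p|)}.
  by apply: continuous_subspaceT => p; apply: cvg_norm; exact: cf.
have [c _ cmax] := compact_EVT_max (ex_intro _ _ K0) cK cnf.
exists `|f c| => // p.
(* These integers are the numbers of periods to subtract in order to bring [p] into the fundamental
   domain [K]. *)
pose a := Num.floor (p.1 / 2); pose b := Num.floor (p.2 / Num.sqrt 3).
rewrite -(periodicZ p (- a) (- b) pf); apply: cmax; rewrite inE.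
have := floor_itv (p.1 / 2); have := floor_itv (p.2 / Num.sqrt 3).
rewrite -/a -/b !intrD !ler_pdivlMr // !ltr_pdivrMr // !mulrNz.
by split; rewrite /= in_itv /=; lra.
Qed.

Lemma continuous_seg (R : realType) (f : R * R -> R) (p h : R * R) :
  continuous f -> continuous (fun t : R => f (p + t *: h)).
Proof.
move=> cf t.
apply: (continuous_comp (f := fun s : R => p + s *: h) (g := f)); last exact: cf.
by apply: cvgD; [exact: cvg_cst|apply: cvgZr_tmp; exact: cvg_id].
Qed.

(** [edge_integral] freed from vertices: the starting point may be any point of the plane, so it can
    be translated by periods and compared with a midpoint. *)
Definition seg (R : realType) (p h : R * R) (phi : form1 R) : R :=
  int01 (fun t => phi.1 (p + t *: h) * h.1 + phi.2 (p + t *: h) * h.2).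

Lemma edge_integralE (R : realType) (n : nat) (e : edge n) :
  @edge_integral R n e = seg (vpos R (src e)) (edge_vec R n e.2).
Proof. by []. Qed.

Lemma form1_C0 (R : realType) (k : nat) (phi : form1 R) :
  form1_C k phi -> form1_C 0 phi.
Proof. by case=> p1 p2 c1 c2; split=> //; split=> //; case: k c1 c2 => [|k] [] // ? _ []. Qed.

Lemma continuous_pullback (R : realType) (p h : R * R) (phi : form1 R) :
  form1_C 0 phi ->
  continuous (fun t : R => phi.1 (p + t *: h) * h.1 + phi.2 (p + t *: h) * h.2).
Proof.
case=> _ _ [c1 _] [c2 _] t.
by apply: cvgD; (apply: cvgM; last exact: cvg_cst); exact: continuous_seg.
Qed.

Lemma seg_lin (R : realType) (p h : R * R) (a : R) (u v : form1 R) :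
  form1_C 0 u -> form1_C 0 v ->
  seg p h (a *: u + v) = a * seg p h u + seg p h v.
Proof.
move=> cu cv; rewrite /seg -int01_lin; try exact: continuous_pullback.
congr int01; apply/funext => t.
have E1 q : (a *: u + v).1 q = a * u.1 q + v.1 q by [].
have E2 q : (a *: u + v).2 q = a * u.2 q + v.2 q by [].
rewrite E1 E2; ring.
Qed.

Lemma seg_bound (R : realType) (p h : R * R) (phi : form1 R) (M1 M2 : R) :
  form1_C 0 phi -> (forall q, `|phi.1 q| <= M1) -> (forall q, `|phi.2 q| <= M2) ->
  `|seg p h phi| <= M1 * `|h.1| + M2 * `|h.2|.
Proof.
move=> cphi b1 b2; apply: int01_bound; first exact: continuous_pullback.
move=> t _; apply: le_trans (ler_normD _ _) _.
by rewrite !normrM lerD // ler_wpM2r.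
Qed.

Lemma seg_periodic (R : realType) (p h : R * R) (phi : form1 R) (a b : int) :
  periodic phi.1 -> periodic phi.2 ->
  seg (p + (a%:~R * 2, b%:~R * Num.sqrt 3)) h phi = seg p h phi.
Proof.
move=> p1 p2; congr int01; apply/funext => t.
by rewrite addrAC !periodicZ.
Qed.

Lemma le_sup_norm (R : realType) (f : R * R -> R) (p : R * R) :
  periodic f -> continuous f -> `|f p| <= sup_norm f.
Proof.
move=> pf cf; have [M _ fM] := periodic_bounded pf cf.
apply: ub_le_sup; last by exists p.
by exists M => _ [q _ <-].
Qed.

Lemma sup_norm_le (R : realType) (f : R * R -> R) (M : R) :
  (forall p, `|f p| <= M) -> sup_norm f <= M.
Proof.
move=> fM; apply: ge_sup; first by exists `|f 0|; exists 0.
by move=> _ [q _ <-].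
Qed.

(** After rescaling [u] into the unit ball, the continuity bound in [in_dual] is what makes the
    supremum a genuine one: [sup] of an unbounded set is a default value. *)
Lemma le_dual_norm (R : realType) (V : lmodType R) (D : set V) (N : V -> R)
    (X : V -> R) (u : V) (c : R) :
  D 0 -> (forall a v, D v -> D (a *: v)) -> (forall v, D v -> 0 <= N v) ->
  in_dual D N X -> D u -> 0 < c -> N (c^-1 *: u) <= 1 -> `|X u| <= c * dual_norm D N X.
Proof.
move=> D0 DZ N0 [Xlin [M XM]] Du c0 Nu.
have X0 : X 0 = 0.
  have := Xlin 1 0 0 D0 D0; rewrite scaler0 addr0 mul1r => /eqP.
  by rewrite -subr_eq0 opprD addrA subrr sub0r oppr_eq0 => /eqP.
have XZ : X u = c * X (c^-1 *: u).
  have := Xlin c^-1 u 0 Du D0; rewrite addr0 X0 addr0 => ->.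
  by rewrite mulrA mulfV ?mul1r // gt_eqF.
rewrite XZ normrM gtr0_norm // ler_pM2l //.
apply: ub_le_sup; last by exists (c^-1 *: u) => //; split=> //; exact: DZ.
exists `|M| => _ [v [Dv Nv] <-]; apply: le_trans (XM v Dv) _.
apply: le_trans (ler_norm _) _; rewrite normrM (ger0_norm (N0 v Dv)).
by rewrite ler_piMr.
Qed.

(** * Duality with the flat norm *)

Lemma periodic_derive (R : realType) (f : R * R -> R) (v : R * R) :
  periodic f -> periodic ('D_v f).
Proof.
move=> pf.
have E (x y a b : R) : ((x, y) : R * R) + (a, b) = (x + a, y + b) by [].
have H (p P : R * R) : (forall q, f (q + P) = f q) -> 'D_v f (p + P) = 'D_v f p.
  move=> fP; rewrite /derive.
  (* The two difference quotients are the same function, which also settles the points where the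
     limit does not exist. *)
  suff -> : (fun h => h^-1 *: ((f \o shift (p + P)) (h *: v) - f (p + P))) =
            (fun h => h^-1 *: ((f \o shift p) (h *: v) - f p)) by [].
  by apply/funext => h /=; rewrite addrA !fP.
case=> x y /=; split.
  have := H (x, y) (2, 0); rewrite E addr0 => -> // -[x' y'].
  by rewrite E addr0; case: (pf (x', y')).
have := H (x, y) (0, Num.sqrt 3); rewrite E addr0 => -> // -[x' y'].
by rewrite E addr0; case: (pf (x', y')).
Qed.

Lemma form1_C0Z (R : realType) (a : R) (u : form1 R) :
  form1_C 0 u -> form1_C 0 (a *: u).
Proof.
have per f : periodic f -> periodic (a *: f).
  move=> pf p; have [H1 H2] := pf p.
  by split; [exact: (congr1 ( *%R a) H1)|exact: (congr1 ( *%R a) H2)].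
have con (f : R * R -> R) : continuous f -> continuous (a *: f).
  by move=> cf p; exact: (@cvgM _ _ _ _ (fun=> a) f _ _ (cvg_cst a) (cf p)).
by case=> p1 p2 [c1 _] [c2 _]; split;
  [exact: per|exact: per|split=> //; exact: con|split=> //; exact: con].
Qed.

Lemma form2_C0Z (R : realType) (a : R) (w : form2 R) :
  form2_C 0 w -> form2_C 0 (a *: w : form2 R).
Proof.
case=> pw [cw _]; split.
  move=> p; have [H1 H2] := pw p.
  by split; [exact: (congr1 ( *%R a) H1)|exact: (congr1 ( *%R a) H2)].
by split=> // p; exact: (@cvgM _ _ _ _ (fun=> a) w _ _ (cvg_cst a) (cw p)).
Qed.

Lemma form1_C0_0 (R : realType) : form1_C 0 (0 : form1 R).
Proof. by split; try (by move=> p); split=> // p; exact: cvg_cst. Qed.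

Lemma form2_C0_0 (R : realType) : form2_C 0 (0 : form2 R).
Proof. by split; try (by move=> p); split=> // p; exact: cvg_cst. Qed.

Lemma sup_norm_ge0 (R : realType) (f : R * R -> R) :
  periodic f -> continuous f -> 0 <= sup_norm f.
Proof. by move=> pf cf; apply: le_trans (le_sup_norm 0 pf cf). Qed.

Lemma current1_pairing (R : realType) (n : nat) (s : chain1 R n) :
  current1 (pairing s).
Proof.
split=> [a u v Du Dv|].
  rewrite /pairing mulr_sumr -big_split; apply: eq_bigr => e _ /=.
  by rewrite !edge_integralE seg_lin //; ring.
exists (\sum_(e : edge n) `|s e| * (`|(edge_vec R n e.2).1| + `|(edge_vec R n e.2).2|)).
move=> u Du; rewrite /pairing mulr_suml; apply: le_trans (ler_norm_sum _ _ _) _.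
apply: ler_sum => e _; rewrite normrM -mulrA ler_wpM2l // edge_integralE.
have [p1 p2 [c1 _] [c2 _]] := Du.
apply: le_trans (seg_bound _ _ Du (fun q => le_sup_norm q p1 c1)
  (fun q => le_sup_norm q p2 c2)) _.
rewrite /norm1; have := sup_norm_ge0 p1 c1; have := sup_norm_ge0 p2 c2.
move: (sup_norm u.1) (sup_norm u.2) => A B B0 A0.
rewrite mulrDl !mulrDr addrA; have := normr_ge0 (edge_vec R n e.2).1.
have := normr_ge0 (edge_vec R n e.2).2; nra.
Qed.

(** Every admissible splitting gives X psi = Y psi + Delta (d psi), and each summand is at most [c]
    times a dual norm. The components of [psi] get c / 2 each because [norm1] adds two sup norms. *)
Lemma flat_norm_dual (R : realType) (X : form1 R -> R) (psi : form1 R) (c : R) :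
  current1 X -> form1_C 1 psi -> 0 < c ->
  (forall p, `|psi.1 p| <= c / 2) -> (forall p, `|psi.2 p| <= c / 2) ->
  (forall p, `|ext_d1 psi p| <= c) ->
  `|X psi| <= c * flat_norm X.
Proof.
move=> cX Cpsi c0 b1 b2 bd; have C0psi := form1_C0 Cpsi.
have [p1 p2 [_ [_ _ _ [cd21 _]]] [_ [_ _ [cd12 _] _]]] := Cpsi.
have cunit (f : R * R -> R) (M : R) : (forall p, `|f p| <= c * M) ->
    sup_norm (c^-1 *: f) <= M.
  move=> fM; apply: sup_norm_le => p.
  have -> : (c^-1 *: f) p = c^-1 * f p by [].
  by rewrite normrM gtr0_norm ?invr_gt0 // mulrC ler_pdivrMr // mulrC.
have Cd : form2_C 0 (ext_d1 psi).
  split.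
    move=> p; rewrite /ext_d1 /d1 /d2.
    have [-> ->] := periodic_derive (1, 0) p2 p.
    by have [-> ->] := periodic_derive (0, 1) p1 p.
  by split=> // p; apply: cvgB; [exact: cd12|exact: cd21].
rewrite mulrC -ler_pdivrMr //; apply: lb_le_inf.
  (* The choice Delta = 0, Y = X shows that the infimum is not over the empty set. *)
  exists (current1_norm X + current2_norm (fun _ : form2 R => 0)), (fun=> 0), X.
  split=> //; last by move=> phi _; rewrite /bd_current2 subr0.
  split; first by move=> *; rewrite mulr0 addr0.
  by exists 0 => u _; rewrite normr0 mul0r.
move=> r [Delta [Y [cD cY YE ->]]]; rewrite ler_pdivrMr // mulrC mulrDr.
(* Here [psi] has to be C^1, since [Y] is tied to [X] on such forms only. *)
have -> : X psi = Y psi + Delta (ext_d1 psi) by rewrite YE // /bd_current2 subrK.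
apply: le_trans (ler_normD _ _) _; apply: lerD; apply: le_dual_norm => //.
- exact: form1_C0_0.
- by move=> a v; exact: form1_C0Z.
- by move=> v [q1 q2 [k1 _] [k2 _]]; rewrite addr_ge0 // sup_norm_ge0.
- rewrite (splitr 1) lerD // cunit // => p; rewrite mul1r //.
- exact (form2_C0_0 R).
- by move=> a v; exact: form2_C0Z.
- by move=> v [q1 [k1 _]]; exact: sup_norm_ge0.
- by apply: cunit => p; rewrite mulr1.
Qed.

(** * Taylor expansion along the axes *)

Lemma mean_value_bound (R : realType) (h h' : R -> R) (B t : R) :
  (forall s : R, is_derive s 1 h (h' s)) ->
  (forall s, `|s| <= `|t| -> `|h' s| <= B) -> `|h t - h 0| <= B * `|t|.
Proof.
move=> dh h'B.
have ch : continuous h.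
  by move=> s; apply/differentiable_continuous/derivable1_diffP; case: (dh s).
have [t0|t0] := leP 0 t.
  have [c] := MVT_segment t0 (fun s _ => dh s) (continuous_subspaceT ch).
  rewrite in_itv /= => /andP[c0 ct] ->; rewrite subr0 normrM ler_wpM2r //.
  by apply: h'B; rewrite !ger0_norm.
have [c] := MVT_segment (ltW t0) (fun s _ => dh s) (continuous_subspaceT ch).
rewrite in_itv /= => /andP[c0 ct] E.
rewrite distrC E sub0r normrM normrN ler_wpM2r //.
by apply: h'B; rewrite !ler0_norm ?lerN2 // ltW.
Qed.

(** [g i] plays the part of the i-th derivative, so that differentiating the polynomial amounts to
    shifting the family. *)
Definition taylor_poly (R : realType) (g : nat -> R -> R) (k : nat) : {poly R} :=
  \poly_(i < k) (g i 0 / i`!%:R).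

Lemma deriv_taylor_poly (R : realType) (g : nat -> R -> R) (k : nat) :
  (taylor_poly g k.+1)^`()%R = taylor_poly (fun i => g i.+1) k.
Proof.
apply/polyP => i; rewrite coef_deriv !coef_poly ltnS.
case: ifP => _; last by rewrite mul0rn.
have f0 : i`!%:R != 0 :> R by rewrite pnatr_eq0 -lt0n fact_gt0.
have i0 : i.+1%:R != 0 :> R by rewrite pnatr_eq0.
by rewrite factS natrM -mulr_natr; field; rewrite -natr1 in i0; rewrite f0 /= addrC i0.
Qed.

(** Induction through the mean value inequality: the remainder of order k+1 has the remainder of
    order k of the shifted family as its derivative. The factor 1 / k! is lost, which is
    harmless. *)
Lemma taylor_bound (R : realType) (k : nat) (g : nat -> R -> R) (M t : R) :
  (forall i (s : R), (i < k)%N -> is_derive s 1 (g i) (g i.+1 s)) ->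
  (forall s, `|g k s| <= M) ->
  `|g 0%N t - (taylor_poly g k).[t]| <= M * `|t| ^+ k.
Proof.
elim: k g t => [|k IH] g t dg gM.
  by rewrite /taylor_poly poly_def big_ord0 horner0 subr0 expr0 mulr1.
have M0 : 0 <= M by apply: le_trans (gM 0).
pose h s := g 0%N s - (taylor_poly g k.+1).[s].
have h0 : h 0 = 0.
  by rewrite /h horner_coef0 coef_poly /= fact0 divr1 subrr.
have dh (s : R) : is_derive s 1 h (g 1%N s - (taylor_poly g k.+1)^`()%R.[s]).
  by apply: is_deriveB; exact: dg.
have := @mean_value_bound R h _ (M * `|t| ^+ k) t dh.
rewrite h0 subr0 -mulrA -exprSr; apply=> s st.
rewrite deriv_taylor_poly.
apply: le_trans (IH (fun i => g i.+1) s _ gM) _; first by move=> i s'; exact: (dg i.+1).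
by rewrite ler_wpM2l // lerXn2r ?nnegrE.
Qed.

Lemma is_derive_line (R : realType) (f : R * R -> R) (p v : R * R) (t : R) :
  derivable f (p + t *: v) v ->
  is_derive t 1 (fun s : R => f (p + s *: v)) ('D_v f (p + t *: v)).
Proof.
have E : (fun h : R => h^-1 *: (((fun s : R => f (p + s *: v)) \o shift t) (h *: 1)
            - f (p + t *: v))) =
         (fun h => h^-1 *: ((f \o shift (p + t *: v)) (h *: v) - f (p + t *: v))).
  apply/funext => h /=; congr (_ *: (f _ - _)).
  by rewrite scalerDl -[h *: 1]/(h * 1) mulr1 addrCA.
by move=> df; split; rewrite /derivable /derive E.
Qed.

Definition is_axis (R : realType) (v : R * R) : Prop := v = (1, 0) \/ v = (0, 1).

Lemma class_C_derive (R : realType) (k : nat) (f : R * R -> R) (v : R * R) :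
  is_axis v -> class_C k.+1 f ->
  class_C k ('D_v f) /\ forall p, derivable f p v.
Proof. by move=> [->|->] [_ [D1 D2 C1 C2]]; split; [exact: C1|exact: D1|exact: C2|exact: D2]. Qed.

Lemma class_C_iter (R : realType) (k i : nat) (f : R * R -> R) (v : R * R) :
  is_axis v -> class_C (i + k) f -> class_C k (iter i (fun g : R * R -> R => 'D_v g) f).
Proof.
move=> av; elim: i k => // i IH k /= Cf.
have Cf' : class_C (i + k.+1) f by rewrite addnS.
by have [] := class_C_derive av (IH _ Cf').
Qed.

Lemma periodic_iter (R : realType) (i : nat) (f : R * R -> R) (v : R * R) :
  periodic f -> periodic (iter i (fun g : R * R -> R => 'D_v g) f).
Proof. by move=> pf; elim: i => //= i IH; exact: periodic_derive. Qed.

(* Differentiating along [v] first and along [u] afterwards, the expansion only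
   involves the mixed derivatives in one order, so no symmetry of second
   derivatives is needed. *)
Definition mixed (R : realType) (u v : R * R) (i j : nat) (f : R * R -> R) :=
  iter i (fun g : R * R -> R => 'D_u g) (iter j (fun g : R * R -> R => 'D_v g) f).

(** The function is expanded along [v] from m + x u, then its j-th coefficient along [u] to the
    complementary order k - j. All remainders involve derivatives of total order k, which are
    continuous and periodic; hence [M] does not depend on [m]. *)
Lemma taylor2 (R : realType) (k : nat) (f : R * R -> R) (u v : R * R) :
  is_axis u -> is_axis v -> periodic f -> class_C k f ->
  exists2 M : R, 0 <= M & forall (m : R * R) (x y : R),
    `|f (m + x *: u + y *: v) - \sum_(j < k)
        (\sum_(i < k - j) mixed u v i j f m / i`!%:R * x ^+ i) / j`!%:R * y ^+ j|
      <= M * (`|x| + `|y|) ^+ k.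
Proof.
move=> au av pf Cf.
have Cm i j : (i + j <= k)%N -> class_C (k - (i + j)) (mixed u v i j f).
  move=> ijk; apply: class_C_iter => //; apply: class_C_iter => //.
  by rewrite (_ : (_ + _)%N = k) //; lia.
have dm i j p : (i + j < k)%N -> derivable (mixed u v i j f) p u.
  move=> ijk; have := Cm i j (ltnW ijk).
  by rewrite (_ : (k - (i + j) = (k - (i + j).+1).+1)%N); [case/(class_C_derive au)|lia].
have dn j p : (j < k)%N -> derivable (iter j (fun g : R * R -> R => 'D_v g) f) p v.
  move=> jk; have := Cm 0%N j (ltnW jk); rewrite /mixed /= add0n.
  by rewrite (_ : (k - j = (k - j.+1).+1)%N); [case/(class_C_derive av)|lia].
have bm (j : 'I_k.+1) :
    exists M : R, 0 <= M /\ forall p, `|mixed u v (k - j) j f p| <= M.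
  have jk : (j <= k)%N by rewrite -ltnS.
  have := Cm (k - j)%N j; rewrite subnK // subnn => /(_ (leqnn k)) [cm _].
  have [M M0 H] := periodic_bounded (periodic_iter (k - j) u (periodic_iter j v pf)) cm.
  by exists M.
have [Mj MjP] := choice bm; pose M := \sum_j Mj j.
have M0 : 0 <= M by apply: sumr_ge0 => j _; case: (MjP j).
have bM j p : (j <= k)%N -> `|mixed u v (k - j) j f p| <= M.
  rewrite -ltnS => jk; case: (MjP (Ordinal jk)) => _ H; apply: le_trans (H p) _.
  rewrite /M (bigD1 (Ordinal jk)) //= lerDl sumr_ge0 // => i _.
  by case: (MjP i).
(* The first term pays for the remainder along [v], the sum for those of the coefficients along
   [u]. *)
clearbody M; exists (M + \sum_(j < k) M / j`!%:R).
  by rewrite addr_ge0 // sumr_ge0 // => j _; rewrite divr_ge0.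
move=> m x y.
have Dv : `|f (m + x *: u + y *: v) - \sum_(j < k)
    (iter j (fun g : R * R -> R => 'D_v g) f (m + x *: u)) / j`!%:R * y ^+ j| <= M * `|y| ^+ k.
  have := @taylor_bound R k
    (fun j t => iter j (fun g : R * R -> R => 'D_v g) f (m + x *: u + t *: v)) M y.
  rewrite /taylor_poly horner_poly /= scale0r addr0; apply.
    by move=> i s ik; apply: is_derive_line; exact: dn.
  by move=> s; have := bM k (m + x *: u + s *: v) (leqnn k); rewrite subnn.
have Du (j : 'I_k) : `|iter j (fun g : R * R -> R => 'D_v g) f (m + x *: u) -
    \sum_(i < k - j) mixed u v i j f m / i`!%:R * x ^+ i| <= M * `|x| ^+ (k - j).
  have := @taylor_bound R (k - j)%N (fun i t => mixed u v i j f (m + t *: u)) M x.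
  rewrite /taylor_poly horner_poly /= scale0r addr0; apply.
    move=> i s ik; apply: is_derive_line; apply: dm.
    by have := ltn_ord j; lia.
  by move=> s; apply: bM; exact: ltnW.
rewrite mulrDl mulr_suml.
rewrite -[X in `|X|](subrKA (\sum_(j < k)
    (iter j (fun g : R * R -> R => 'D_v g) f (m + x *: u)) / j`!%:R * y ^+ j)).
apply: le_trans (ler_normD _ _) _; apply: lerD.
  apply: le_trans Dv _; rewrite ler_wpM2l // lerXn2r ?nnegrE ?addr_ge0 //.
  by rewrite lerDr.
rewrite -sumrB; apply: le_trans (ler_norm_sum _ _ _) _.
apply: ler_sum => j _; rewrite -!mulrBl !normrM normrX normfV [`|j`!%:R|]ger0_norm //.
rewrite [X in X * _]mulrC [X in _ <= X * _]mulrC -!mulrA ler_wpM2l ?invr_ge0 //.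
apply: le_trans (ler_wpM2r _ (Du j)) _ => //; rewrite -mulrA ler_wpM2l //.
have jk : (j <= k)%N by exact: ltnW.
rewrite -[X in _ <= _ ^+ X](subnK jk) exprD.
by apply: ler_pM => //; rewrite lerXn2r ?nnegrE ?addr_ge0 // ?lerDl ?lerDr.
Qed.

(** * Consistency at an edge *)

Definition cubic (R : realType) (a : nat -> nat -> R) (z : R * R) : R :=
  a 0%N 0%N + a 1%N 0%N * z.1 + a 0%N 1%N * z.2
  + a 2%N 0%N * z.1 ^+ 2 + a 1%N 1%N * z.1 * z.2 + a 0%N 2%N * z.2 ^+ 2
  + a 3%N 0%N * z.1 ^+ 3 + a 2%N 1%N * z.1 ^+ 2 * z.2
  + a 1%N 2%N * z.1 * z.2 ^+ 2 + a 0%N 3%N * z.2 ^+ 3.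

(* The integral of the form with cubic coefficients over the segment from [y] to
   [y + h]: Simpson's rule is exact in degree 3. *)
Definition simpson (R : realType) (a b : nat -> nat -> R) (y h : R * R) : R :=
  let w z := cubic a z * h.1 + cubic b z * h.2 in
  (w y + 4 * w (y.1 + h.1 / 2, y.2 + h.2 / 2) + w (y.1 + h.1, y.2 + h.2)) / 6.

(** Affine functions in the format of [cubic], so that [simpson] also serves for [Lup phi]. *)
Definition affine_coef (R : realType) (c0 c1 c2 : R) (i j : nat) : R :=
  match i, j with 0%N, 0%N => c0 | 1%N, 0%N => c1 | 0%N, 1%N => c2 | _, _ => 0 end.

(** [edge_vec] with the mesh and sqrt 3 as parameters, which turns the identities below into
    rational ones that [field] decides. *)
Definition dir (R : realType) (e s : R) (k : nat) : R * R :=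
  match k with
  | 0%N => (2 * e, 0)
  | 1%N => (e, s * e)
  | _ => (- e, s * e)
  end.

(** [E p h] stands for the integral from p to p + h. It stays abstract because both [seg] and
    [simpson] are substituted for it. *)
Definition up_bd (R : realType) (e s : R) (E : R * R -> R * R -> R) (p : R * R) :=
  E p (2 * e, 0) - E p (e, s * e) + E (p.1 + 2 * e, p.2) (- e, s * e).

Definition down_bd (R : realType) (e s : R) (E : R * R -> R * R -> R) (p : R * R) :=
  E p (e, s * e) - E p (- e, s * e) - E (p.1 - e, p.2 + s * e) (2 * e, 0).

(* The boundary of the triangle to the left of the edge in direction [k] issued
   from [p] minus that of the triangle to its right. *)
Definition bd_jump (R : realType) (e s : R) (E : R * R -> R * R -> R) (k : nat)
    (p : R * R) :=
  match k with
  | 0%N => up_bd e s E p - down_bd e s E (p.1 + e, p.2 - s * e)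
  | 1%N => down_bd e s E p - up_bd e s E p
  | _ => up_bd e s E (p.1 - 2 * e, p.2) - down_bd e s E p
  end.

Definition midpoint (R : realType) (p h : R * R) : R * R :=
  (p.1 + h.1 / 2, p.2 + h.2 / 2).

(* The symmetry about the midpoint exchanges the two triangles, so the terms of odd
   degree contribute neither to the jump nor, in the affine form, to the integral
   over the edge: [c1], [c2], [c3] and [c4] are arbitrary. *)
Lemma bd_jump_cubic (R : realType) (a b : nat -> nat -> R) (c1 c2 c3 c4 e s : R)
    (k : nat) (p : R * R) :
  let m := midpoint p (dir e s k) in
  s != 0 -> s ^+ 2 = 3 ->
  bd_jump e s (fun q h => simpson a b (q.1 - m.1, q.2 - m.2) h) k p
  + e ^+ 2 * simpson (affine_coef (2 * a 0%N 2%N - b 1%N 1%N) c1 c2)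
      (affine_coef (2 * b 2%N 0%N - a 1%N 1%N) c3 c4)
      (p.1 - m.1, p.2 - m.2) (dir e s k) = 0.
Proof.
move=> m s0 s2.
(* Heights are measured in units of [s], and [b] absorbs one more factor from dx2. The powers of [s]
   then cancel, except in 2 a02 - b11, where s^2 = 3 enters. *)
pose a' i j := a i j * s ^+ j; pose b' i j := b i j * s ^+ j.+1.
have aE i j : a i j = a' i j / s ^+ j by rewrite /a' mulfK // expf_neq0.
have bE i j : b i j = b' i j / s ^+ j.+1 by rewrite /b' mulfK // expf_neq0.
rewrite /m /simpson /cubic /affine_coef !(aE, bE); clearbody a' b' => {aE bE}.
have -> : 2 * (a' 0%N 2%N / s ^+ 2) - b' 1%N 1%N / s ^+ 2 =
          (2 * a' 0%N 2%N - b' 1%N 1%N) / 3 by rewrite s2; field.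
case: p m => x y m; case: k m => [|[|k]] m;
 by cbv beta iota zeta delta [fst snd bd_jump up_bd down_bd dir midpoint]; field; rewrite s0.
Qed.

(** The coefficients are read off from finite differences of the values at -1, 0, 1 and 2, which
    avoids expanding the two-variable cubics. *)
Lemma cubic_interpolation (R : realType) (a b : nat -> nat -> R) (y h : R * R) :
  exists c0 c1 c2 c3 : R, forall t : R,
    cubic a (y.1 + t * h.1, y.2 + t * h.2) * h.1
    + cubic b (y.1 + t * h.1, y.2 + t * h.2) * h.2
    = c0 + c1 * t + c2 * t ^+ 2 + c3 * t ^+ 3.
Proof.
pose w t := cubic a (y.1 + t * h.1, y.2 + t * h.2) * h.1
    + cubic b (y.1 + t * h.1, y.2 + t * h.2) * h.2.
pose c2 := (w 1 + w (-1)) / 2 - w 0.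
pose c3 := (w 2 - 3 * w 1 + 3 * w 0 - w (- 1)) / 6.
exists (w 0), (w 1 - w 0 - c2 - c3), c2, c3 => t.
by rewrite /c3 /c2 /w /cubic /=; field.
Qed.

Lemma seg_simpson (R : realType) (phi : form1 R) (a b : nat -> nat -> R)
    (m q h : R * R) (r d : R) :
  form1_C 0 phi ->
  (forall z : R * R, `|z.1| + `|z.2| <= r ->
     `|phi.1 (m + z) - cubic a z| <= d /\ `|phi.2 (m + z) - cubic b z| <= d) ->
  `|q.1 - m.1| + `|q.2 - m.2| + `|h.1| + `|h.2| <= r ->
  `|seg q h phi - simpson a b (q.1 - m.1, q.2 - m.2) h| <= d * (`|h.1| + `|h.2|).
Proof.
move=> Cphi ab qr.
set y := (q.1 - m.1, q.2 - m.2).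
pose w t := cubic a (y.1 + t * h.1, y.2 + t * h.2) * h.1
    + cubic b (y.1 + t * h.1, y.2 + t * h.2) * h.2.
have [c0 [c1 [c2 [c3 wE]]]] := cubic_interpolation a b y h.
have cw : continuous w.
  have -> : w = horner (c0%:P + c1 *: 'X + c2 *: 'X^2 + c3 *: 'X^3).
    apply/funext => t; rewrite /w wE.
    by rewrite !(hornerD, hornerZ, hornerX, hornerXn, hornerC).
  exact: continuous_horner.
have -> : simpson a b y h = int01 w.
  have -> : w = (fun t => c0 + c1 * t + c2 * t ^+ 2 + c3 * t ^+ 3).
    by apply/funext => t; rewrite /w wE.
  rewrite int01_simpson -!wE /simpson !mul0r !mul1r !addr0.
  by rewrite ![_ / 2]mulrC; case: (y).
have cp := @continuous_pullback R q h phi Cphi.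
(* The difference of integrals is put in the shape -1 * int w + int of the pullback that [int01_lin]
   expects. *)
rewrite -[int01 w]mul1r -mulN1r mulrA mulr1.
rewrite /seg addrC -int01_lin //; apply: int01_bound.
  by move=> t; apply: cvgD; [apply: cvgM; [exact: cvg_cst|exact: cw]|exact: cp].
move=> t /andP[t0 t1]; rewrite mulN1r addrC.
have [|e1 e2] := ab (y.1 + t * h.1, y.2 + t * h.2).
  have le_th (u v : R) : `|u + t * v| <= `|u| + `|v|.
    by rewrite (le_trans (ler_normD _ _)) // lerD2l normrM ger0_norm // ler_piMl.
  have := le_th y.1 h.1; have := le_th y.2 h.2; rewrite /=; lra.
have mz : m + (y.1 + t * h.1, y.2 + t * h.2) = q + t *: h.
  case: q @y {qr cp w cw wE e1 e2} => q1 q2 /=; case: m {ab} => m1 m2 /=.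
  by case: h => h1 h2; congr pair => /=; rewrite addrA addrCA subrr addr0.
rewrite mz in e1 e2.
rewrite /w opprD addrACA -!mulrBl mulrDr; apply: le_trans (ler_normD _ _) _.
by rewrite !normrM lerD // ler_wpM2r.
Qed.

Lemma pair_axes (R : realType) (z : R * R) : z = z.1 *: (1, 0) + z.2 *: (0, 1).
Proof.
case: z => x y; congr pair => /=.
  by rewrite -[RHS]/(x * 1 + y * 0) mulr1 mulr0 addr0.
by rewrite -[RHS]/(x * 0 + y * 1) mulr1 mulr0 add0r.
Qed.

Lemma cubic_sum (R : realType) (g : nat -> nat -> R) (x y : R) :
  \sum_(j < 4) (\sum_(i < 4 - j) g i j / i`!%:R * x ^+ i) / j`!%:R * y ^+ j
  = cubic (fun i j => g i j / i`!%:R / j`!%:R) (x, y).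
Proof.
have f1 : 1`! = 1%N by []. have f2 : 2`! = 2%N by []. have f3 : 3`! = 6%N by [].
by rewrite /cubic !(big_ord_recl, big_ord0) /= /bump /= ?add1n ?f1 ?f2 ?f3 ?fact0; field.
Qed.

Lemma cubic_swap (R : realType) (a : nat -> nat -> R) (x y : R) :
  cubic a (x, y) = cubic (fun i j => a j i) (y, x).
Proof. by rewrite /cubic /=; ring. Qed.

(** Used for the first component of [phi]: the order of expansion makes the mixed coefficient d1 d2,
    the one in which this component enters [Lup]. *)
Lemma taylor_cubic12 (R : realType) (f : R * R -> R) :
  periodic f -> class_C 4 f ->
  exists2 M : R, 0 <= M & forall m, exists a : nat -> nat -> R,
    [/\ a 0%N 2%N = d2 (d2 f) m / 2, a 1%N 1%N = d1 (d2 f) m &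
        forall z, `|f (m + z) - cubic a z| <= M * (`|z.1| + `|z.2|) ^+ 4].
Proof.
move=> pf Cf.
have [M M0 fM] := taylor2 (or_introl erefl) (or_intror erefl) pf Cf.
exists M => // m; exists (fun i j => mixed (1, 0) (0, 1) i j f m / i`!%:R / j`!%:R).
split; [by rewrite /mixed /= fact0 divr1|by rewrite /mixed /= !divr1|].
move=> z; rewrite [in f _](pair_axes z) addrA.
have := fM m z.1 z.2.
by rewrite (cubic_sum (fun i j => mixed (1, 0) (0, 1) i j f m)); case: z.
Qed.

(** The counterpart for the second component, which enters [Lup] through d2 d1. *)
Lemma taylor_cubic21 (R : realType) (f : R * R -> R) :
  periodic f -> class_C 4 f ->
  exists2 M : R, 0 <= M & forall m, exists a : nat -> nat -> R,
    [/\ a 2%N 0%N = d1 (d1 f) m / 2, a 1%N 1%N = d2 (d1 f) m &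
        forall z, `|f (m + z) - cubic a z| <= M * (`|z.1| + `|z.2|) ^+ 4].
Proof.
move=> pf Cf.
have [M M0 fM] := taylor2 (or_intror erefl) (or_introl erefl) pf Cf.
exists M => // m; exists (fun i j => mixed (0, 1) (1, 0) j i f m / j`!%:R / i`!%:R).
split; [by rewrite /mixed /= fact0 divr1|by rewrite /mixed /= !divr1|].
move=> z; rewrite [in f _](pair_axes z) [_ *: _ + _]addrC addrA.
have := fM m z.2 z.1.
rewrite (cubic_sum (fun i j => mixed (0, 1) (1, 0) i j f m)) cubic_swap.
by rewrite [`|z.2| + _]addrC; case: z.
Qed.

Lemma taylor_affine (R : realType) (f : R * R -> R) :
  periodic f -> class_C 2 f ->
  exists2 M : R, 0 <= M & forall m, exists c1 c2 : R,
    forall z, `|f (m + z) - cubic (affine_coef (f m) c1 c2) z|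
                <= M * (`|z.1| + `|z.2|) ^+ 2.
Proof.
move=> pf Cf.
have [M M0 fM] := taylor2 (or_introl erefl) (or_intror erefl) pf Cf.
exists M => // m; exists (d1 f m), (d2 f m) => z.
rewrite [in f _](pair_axes z) addrA; have := fM m z.1 z.2.
suff -> : \sum_(j < 2) (\sum_(i < 2 - j)
      mixed (1, 0) (0, 1) i j f m / i`!%:R * z.1 ^+ i) / j`!%:R * z.2 ^+ j
    = cubic (affine_coef (f m) (d1 f m) (d2 f m)) z by [].
have sumE (g : nat -> nat -> R) x y :
    \sum_(j < 2) (\sum_(i < 2 - j) g i j / i`!%:R * x ^+ i) / j`!%:R * y ^+ j
    = cubic (affine_coef (g 0%N 0%N) (g 1%N 0%N) (g 0%N 1%N)) (x, y).
  have f1 : 1`! = 1%N by [].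
  by rewrite /cubic !(big_ord_recl, big_ord0) /= /bump /= ?add1n ?f1 ?fact0; field.
by rewrite (sumE (fun i j => mixed (1, 0) (0, 1) i j f m)); case: (z).
Qed.

Lemma dir_bound (R : realType) (e s : R) (k : nat) :
  0 <= e -> 0 <= s <= 2 ->
  `|(dir e s k).1| <= 2 * e /\ `|(dir e s k).2| <= 2 * e.
Proof.
move=> e0 /andP[s0 s2]; case: k => [|[|k]] /=; rewrite ?normrN ?normr0;
  rewrite ?ger0_norm ?mulr_ge0 //; split; nra.
Qed.

(** The jump is a signed sum of six values of [E], the common edge counting twice, and all six
    segments start within 2e of [p] in each coordinate. *)
Lemma bd_jump_dist (R : realType) (e s d : R) (E S : R * R -> R * R -> R) (k : nat)
    (p : R * R) :
  0 <= e -> 0 <= s <= 2 ->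
  (forall q j, `|q.1 - p.1| <= 2 * e -> `|q.2 - p.2| <= 2 * e ->
     `|E q (dir e s j) - S q (dir e s j)| <= d) ->
  `|bd_jump e s E k p - bd_jump e s S k p| <= 6 * d.
Proof.
move=> e0 /andP[s0 s2] ES.
have se0 : 0 <= s * e by rewrite mulr_ge0.
have se2 : s * e <= 2 * e by rewrite ler_wpM2r.
have B (x y : R) j : `|x| <= 2 * e -> `|y| <= 2 * e ->
    - d <= E (p.1 + x, p.2 + y) (dir e s j) - S (p.1 + x, p.2 + y) (dir e s j) <= d.
  move=> x2 y2; rewrite -ler_norml; apply: ES => /=; by rewrite addrAC subrr add0r.
have p0 : p = (p.1 + 0, p.2 + 0) by rewrite !addr0; case: (p).
have n0 : `|0 : R| <= 2 * e by rewrite normr0 mulr_ge0.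
have ne : `|e| <= 2 * e by rewrite ger0_norm //; lra.
have ne' : `|- e| <= 2 * e by rewrite normrN.
have n2 : `|2 * e| <= 2 * e by rewrite ger0_norm // mulr_ge0.
have n2' : `|- (2 * e)| <= 2 * e by rewrite normrN.
have ns : `|s * e| <= 2 * e by rewrite ger0_norm.
have ns' : `|- (s * e)| <= 2 * e by rewrite normrN.
have b0 j : - d <= E p (dir e s j) - S p (dir e s j) <= d by rewrite p0; exact: B.
have bx x j : `|x| <= 2 * e ->
    - d <= E (p.1 + x, p.2) (dir e s j) - S (p.1 + x, p.2) (dir e s j) <= d.
  by move=> /(B x 0); rewrite addr0; apply.
rewrite ler_norml /bd_jump /up_bd /down_bd.
case: k => [|[|k]] /=.
- rewrite addrK subrK -[(p.1, p.2)]surjective_pairing.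
  have := b0 0%N; have := b0 1%N; have := bx _ 2%N n2.
  have := B _ _ 1%N ne ns'; have := B _ _ 2%N ne ns'.
  by move=> /= /andP[? ?] /andP[? ?] /andP[? ?] /andP[? ?] /andP[? ?]; apply/andP; split; lra.
- have := b0 0%N; have := b0 1%N; have := b0 2%N; have := bx _ 2%N n2.
  have := B _ _ 0%N ne' ns.
  by move=> /= /andP[? ?] /andP[? ?] /andP[? ?] /andP[? ?] /andP[? ?]; apply/andP; split; lra.
- rewrite subrK -[(p.1, p.2)]surjective_pairing.
  have := b0 1%N; have := b0 2%N; have := bx _ 0%N n2'; have := bx _ 1%N n2'.
  have := B _ _ 0%N ne' ns.
  by move=> /= /andP[? ?] /andP[? ?] /andP[? ?] /andP[? ?] /andP[? ?]; apply/andP; split; lra.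
Qed.

Lemma class_C_le (R : realType) (j k : nat) (f : R * R -> R) :
  (j <= k)%N -> class_C k f -> class_C j f.
Proof.
elim: j k f => [|j IH] [|k] f // jk [cf Cf]; first by split.
by split=> //; case: Cf => d1f d2f C1f C2f; split=> //; exact: (IH k).
Qed.

Lemma form1_C_Lup (R : realType) (phi : form1 R) : form1_C 2 phi -> form1_C 0 (Lup phi).
Proof.
move=> C2; rewrite (LupE C2).
case: C2 => p1 p2 [_ [_ _ [_ [_ _ _ [c12 _]]] [_ [_ _ [c21 _] [c22 _]]]]].
case=> _ [_ _ [_ [_ _ [k11 _] [k12 _]]] [_ [_ _ [k21 _] _]]].
have perB (f g : R * R -> R) : periodic f -> periodic g -> periodic (fun p => f p - g p).
  by move=> pf pg p; have [-> ->] := pf p; have [-> ->] := pg p.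
have conB (f g : R * R -> R) : continuous f -> continuous g -> continuous (fun p => f p - g p).
  by move=> cf cg p; apply: cvgB; [exact: cf|exact: cg].
split=> /=.
- by apply: perB; do 2 apply: periodic_derive.
- by apply: perB; do 2 apply: periodic_derive.
- by split=> //; exact: conB.
- by split=> //; exact: conB.
Qed.

Lemma affine_coefB (R : realType) (a b c a' b' c' x x' M M' : R) (z : R * R) :
  `|x - cubic (affine_coef a b c) z| <= M ->
  `|x' - cubic (affine_coef a' b' c') z| <= M' ->
  `|x - x' - cubic (affine_coef (a - a') (b - b') (c - c')) z| <= M + M'.
Proof.
move=> xM xM'; apply: le_trans (lerD xM xM'); apply: le_trans (ler_normB _ _).
by rewrite le_eqVlt; apply/orP; left; apply/eqP; congr `|_|; rewrite /cubic /affine_coef; ring.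
Qed.

(** With cubic Taylor polynomials for [phi] and affine ones for [Lup phi], both at the midpoint, the
    main terms cancel exactly by [bd_jump_cubic]. What remains is e^4 times a length e, and e^2
    times e^2 times a length e. *)
Lemma bd_jump_seg (R : realType) (phi : form1 R) : form1_C 4 phi ->
  exists2 C : R, 0 <= C & forall (e : R) (k : nat) (p : R * R), 0 <= e ->
    `|bd_jump e (Num.sqrt 3) (fun q h => seg q h phi) k p
      + e ^+ 2 * seg p (dir e (Num.sqrt 3) k) (Lup phi)| <= C * e ^+ 5.
Proof.
move=> C4; have [p1 p2 c1 c2] := C4; have C0 := form1_C0 C4.
have C2 : form1_C 2 phi by split=> //; exact: (@class_C_le _ 2 4).
have CL := form1_C_Lup C2.
have ax1 : is_axis ((1, 0) : R * R) by left.
have ax2 : is_axis ((0, 1) : R * R) by right.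
have C2D (u v : R * R) f : is_axis u -> is_axis v -> class_C 4 f -> class_C 2 ('D_u ('D_v f)).
  move=> au av Cf; have [Cv _] := class_C_derive av Cf.
  by have [] := class_C_derive au Cv.
have pD (u v : R * R) f : periodic f -> periodic ('D_u ('D_v f)).
  by move=> pf; do 2 apply: periodic_derive.
have [M1 M10 H1] := taylor_cubic12 p1 c1.
have [M2 M20 H2] := taylor_cubic21 p2 c2.
have [M3 M30 H3] := taylor_affine (pD (0, 1) (0, 1) _ p1) (C2D _ _ _ ax2 ax2 c1).
have [M4 M40 H4] := taylor_affine (pD (0, 1) (1, 0) _ p2) (C2D _ _ _ ax2 ax1 c2).
have [M5 M50 H5] := taylor_affine (pD (1, 0) (1, 0) _ p2) (C2D _ _ _ ax1 ax1 c2).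
have [M6 M60 H6] := taylor_affine (pD (1, 0) (0, 1) _ p1) (C2D _ _ _ ax1 ax2 c1).
pose M := M1 + M2; pose M' := M3 + M4 + M5 + M6.
(* 24 is six segments times |h.1| + |h.2| <= 4e; 16e is a generous radius around the midpoint
   containing all the segments. *)
exists (24 * 16 ^+ 4 * M + 4 * 16 ^+ 2 * M').
  by rewrite addr_ge0 // mulr_ge0 ?addr_ge0 // mulr_ge0.
move=> e k p e0; set s := Num.sqrt 3; pose h := dir e s k.
have s0 : s != 0 by rewrite gt_eqF // sqrtr_gt0.
have s2 : s ^+ 2 = 3 by rewrite sqr_sqrtr.
have s3 : 0 <= s <= 2.
  rewrite sqrtr_ge0 /=; have : 0 <= s by exact: sqrtr_ge0.
  move: s2; rewrite expr2; nra.
pose m := midpoint p h.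
have [a [a02 a11 Ha]] := H1 m; have [b [b20 b11 Hb]] := H2 m.
have [x3 [y3 H3']] := H3 m; have [x4 [y4 H4']] := H4 m.
have [x5 [y5 H5']] := H5 m; have [x6 [y6 H6']] := H6 m.
have dbl (x : R) : 2 * (x / 2) = x by field.
have E1 : 2 * a 0%N 2%N - b 1%N 1%N = d2 (d2 phi.1) m - d2 (d1 phi.2) m.
  rewrite a02 b11 dbl; reflexivity.
have E2 : 2 * b 2%N 0%N - a 1%N 1%N = d1 (d1 phi.2) m - d1 (d2 phi.1) m.
  rewrite b20 a11 dbl; reflexivity.
(* The free affine slopes are taken to be those of the expansions of the components of [Lup phi]. *)
have := @bd_jump_cubic R a b (x3 - x4) (y3 - y4) (x5 - x6) (y5 - y6) e s k p s0 s2.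
rewrite -/h -/m E1 E2 ;
  clear E1 E2 a02 a11 b20 b11.
set S := fun q h => simpson a b _ _; set SL := simpson (affine_coef _ _ _) _ _ _ => SE.
have [h1 h2] := dir_bound k e0 s3.
have m1 : `|p.1 - m.1| <= e.
  rewrite /m /midpoint /= opprD addrA subrr sub0r normrN normrM.
  by rewrite [`|2^-1|]ger0_norm // ler_pdivrMr // mulrC.
have m2 : `|p.2 - m.2| <= e.
  rewrite /m /midpoint /= opprD addrA subrr sub0r normrN normrM.
  by rewrite [`|2^-1|]ger0_norm // ler_pdivrMr // mulrC.
have dE : `|bd_jump e s (fun q h => seg q h phi) k p - bd_jump e s S k p|
    <= 6 * ((M * (16 * e) ^+ 4) * (4 * e)).
  apply: bd_jump_dist => // q j q1 q2; have [j1 j2] := dir_bound j e0 s3.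
  apply: (@le_trans _ _ ((M * (16 * e) ^+ 4) * (`|(dir e s j).1| + `|(dir e s j).2|))).
    apply: (seg_simpson (r := 16 * e)) => //.
      move=> z zr; have zr4 : (`|z.1| + `|z.2|) ^+ 4 <= (16 * e) ^+ 4.
        by rewrite lerXn2r ?nnegrE ?addr_ge0 ?mulr_ge0.
      split; [apply: le_trans (Ha z) _|apply: le_trans (Hb z) _];
        by rewrite ler_pM ?exprn_ge0 ?addr_ge0 // /M ?lerDl ?lerDr.
    have := ler_distD p.1 q.1 m.1; have := ler_distD p.2 q.2 m.2; lra.
  by rewrite ler_wpM2l ?mulr_ge0 ?addr_ge0 ?exprn_ge0 ?mulr_ge0 //; lra.
have dL : `|seg p h (Lup phi) - SL| <= (M' * (16 * e) ^+ 2) * (4 * e).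
  apply: (@le_trans _ _ ((M' * (16 * e) ^+ 2) * (`|h.1| + `|h.2|))).
    apply: (seg_simpson (r := 16 * e)) => //; last by rewrite /h; lra.
    move=> z zr; have zr2 : (`|z.1| + `|z.2|) ^+ 2 <= (16 * e) ^+ 2.
      by rewrite lerXn2r ?nnegrE ?addr_ge0 ?mulr_ge0.
    have zr0 : 0 <= (`|z.1| + `|z.2|) ^+ 2 by rewrite exprn_ge0 ?addr_ge0.
    have [M'3 M'5] : M3 + M4 <= M' /\ M5 + M6 <= M' by rewrite /M'; split; lra.
    have -> : (Lup phi).1 (m + z) = d2 (d2 phi.1) (m + z) - d2 (d1 phi.2) (m + z).
      by rewrite (LupE C2).
    have -> : (Lup phi).2 (m + z) = d1 (d1 phi.2) (m + z) - d1 (d2 phi.1) (m + z).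
      by rewrite (LupE C2).
    split; [apply: le_trans (affine_coefB (H3' z) (H4' z)) _|
            apply: le_trans (affine_coefB (H5' z) (H6' z)) _];
      by rewrite -mulrDl; apply: ler_pM => //; rewrite addr_ge0.
  by rewrite ler_wpM2l ?mulr_ge0 ?addr_ge0 ?exprn_ge0 ?mulr_ge0 //; lra.
move: SL SE dL => SL SE dL; move: (bd_jump _ _ _ _ _) dE SE => B.
move: (bd_jump _ _ S _ _) => BS dE SE.
(* Subtracting the exact identity [SE] leaves two approximation errors. *)
have -> : B + e ^+ 2 * seg p h (Lup phi)
    = (B - BS) + e ^+ 2 * (seg p h (Lup phi) - SL).
  by rewrite mulrBr addrACA -opprD SE subr0.
apply: le_trans (ler_normD _ _) _.
have dL2 : `|e ^+ 2 * (seg p h (Lup phi) - SL)| <= e ^+ 2 * (M' * (16 * e) ^+ 2 * (4 * e)).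
  by rewrite normrM ger0_norm ?exprn_ge0 // ler_wpM2l ?exprn_ge0.
apply: le_trans (lerD dE dL2) _.
by rewrite le_eqVlt; apply/orP; left; apply/eqP; ring.
Qed.

(** * Combinatorics of the triangulation *)

Lemma ordS_cases (n : nat) (i : 'I_n) :
  (i.+1 < n /\ ordS i = i.+1 :> nat)%N \/ (i.+1 = n /\ ordS i = 0 :> nat)%N.
Proof.
have := ltn_ord i; rewrite /=; case: (ltnP i.+1 n) => h hi.
  by left; rewrite modn_small.
by right; rewrite (_ : i.+1 = n) ?modnn //; lia.
Qed.

Lemma ord_pred_cases (n : nat) (i : 'I_n) :
  (0 < i /\ ord_pred i = i.-1 :> nat)%N \/ (i = 0 :> nat /\ ord_pred i = n.-1 :> nat)%N.
Proof.
have := ordS_cases (ord_pred i); rewrite ord_predK; have := ltn_ord (ord_pred i).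
move: (ord_pred i) => j; case: (i) => /= i' _; lia.
Qed.

(** Written with [inord], as the directions appear in [otriangle_vertices]. *)
Definition dir0 : 'I_3 := inord 0.
Definition dir1 : 'I_3 := inord 1.
Definition dir2 : 'I_3 := inord 2.

Lemma nbr0 (n : nat) (v : vertex n) : nbr v dir0 = (ordS v.1, v.2).
Proof. by rewrite /nbr /dir0 [val _]inordK. Qed.
Lemma nbr1 (n : nat) (v : vertex n) :
  nbr v dir1 = (if odd v.2 then ordS v.1 else v.1, ordS v.2).
Proof. by rewrite /nbr /dir1 [val _]inordK. Qed.
Lemma nbr2 (n : nat) (v : vertex n) :
  nbr v dir2 = (if odd v.2 then v.1 else ord_pred v.1, ordS v.2).
Proof. by rewrite /nbr /dir2 [val _]inordK. Qed.

Lemma dirP (k : 'I_3) : [\/ k = dir0, k = dir1 | k = dir2].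
Proof.
case: k => -[|[|[|//]]] hk; [apply: Or31|apply: Or32|apply: Or33];
  by apply: val_inj; rewrite /= inordK.
Qed.

(** This closes the upward triangle at [v]: its third side is a positively oriented edge in
    direction 2. [nbr20] does the same for the downward triangle and direction 0. *)
Lemma nbr02 (n : nat) (v : vertex n) : nbr (nbr v dir0) dir2 = nbr v dir1.
Proof. by rewrite nbr0 nbr2 nbr1 /= ordSK; case: ifP. Qed.

Lemma nbr20 (n : nat) (v : vertex n) : nbr (nbr v dir2) dir0 = nbr v dir1.
Proof. by rewrite nbr2 nbr0 nbr1 /=; case: ifP => //; rewrite ord_predK. Qed.

Lemma nbr0_bij (n : nat) : bijective (fun v : vertex n => nbr v dir0).
Proof.
apply: injF_bij => -[i j] [i' j']; rewrite !nbr0 => /eqP.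
rewrite xpair_eqE => /andP[/eqP ii /eqP /= ->].
by move: (can_inj (@ordSK n) ii) => /= ->.
Qed.

Lemma nbr2_bij (n : nat) : bijective (fun v : vertex n => nbr v dir2).
Proof.
apply: injF_bij => -[i j] [i' j']; rewrite !nbr2 => /eqP.
rewrite xpair_eqE => /andP[/eqP + /eqP jj].
move: (can_inj (@ordSK n) jj) => /= ->.
by case: ifP => _ => [->|ii] //; move: (can_inj (@ord_predK n) ii) => /= ->.
Qed.

Lemma nbr_inj (n : nat) (v : vertex n) : (2 < n)%N -> injective (@nbr n v).
Proof.
move=> n2 k k' e.
have := congr1 (fun w : vertex n => nat_of_ord w.1) e.
have := congr1 (fun w : vertex n => nat_of_ord w.2) e; move: e => _.
case: v => i j.
have h1 := ordS_cases i; have h2 := ordS_cases j; have h3 := ord_pred_cases i.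
have hi := ltn_ord i; have hj := ltn_ord j.
move: (ordS i) (ordS j) (ord_pred i) h1 h2 h3 (@nbr0 n (i, j)) (@nbr1 n (i, j)) (@nbr2 n (i, j)).
move=> i1 j1 i2 h1 h2 h3 e0 e1 e2.
by case: (dirP k) => ->; case: (dirP k') => -> //; rewrite ?e0 ?e1 ?e2 /=; case: (odd j); lia.
Qed.

(** It keeps the two terms of [edge_chain] from interfering. For n = 2 it fails: two horizontal
    steps return to the start. *)
Lemma nbr_asym (n : nat) (v : vertex n) (k k' : 'I_3) :
  (2 < n)%N -> nbr (nbr v k) k' != v.
Proof.
move=> n2; apply/eqP => e.
have e1 := congr1 (fun w : vertex n => nat_of_ord w.1) e.
have e2 := congr1 (fun w : vertex n => nat_of_ord w.2) e; move: e e1 e2 => _.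
case: v => i j.
have h1 := ordS_cases i; have h2 := ordS_cases j.
have h4 := ordS_cases (ordS i); have h5 := ordS_cases (ordS j).
have hi := ltn_ord i; have hj := ltn_ord j.
case: (dirP k) => ->; case: (dirP k') => ->; rewrite !(nbr0, nbr1, nbr2) [(_, _).2]/= [(_, _).1]/=;
  move: (ordS (ordS i)) (ordS (ordS j)) h4 h5; move: (ordS i) (ordS j) h1 h2 => /=; lia.
Qed.

Lemma edge_chain_nbr (R : realType) (n : nat) (v : vertex n) (k : 'I_3) :
  (2 < n)%N -> edge_chain R v (nbr v k) = [ffun e => (e == (v, k))%:R].
Proof.
move=> n2; apply/ffunP => -[u j]; rewrite !ffunE /src /tgt /=.
rewrite xpair_eqE; case: (u =P v) => [->|uv] /=.
  rewrite (inj_eq (nbr_inj n2)) andbC.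
  case: (v =P nbr v k) => [vk|_]; last by rewrite andbF subr0.
  by have := nbr_asym v k k n2; rewrite -!vk eqxx.
case: (u =P nbr v k) => [->|_]; rewrite ?subr0 //=.
by rewrite (negbTE (nbr_asym _ _ _ n2)) subr0.
Qed.

Lemma edge_chainC (R : realType) (n : nat) (u v : vertex n) :
  edge_chain R u v = - edge_chain R v u.
Proof. by apply/ffunP => e; rewrite !ffunE opprB. Qed.

Lemma chain_dotDl (R : realType) (n : nat) (s t r : chain1 R n) :
  chain_dot (s + t) r = chain_dot s r + chain_dot t r.
Proof. by rewrite /chain_dot -big_split; apply: eq_bigr => e _; rewrite ffunE mulrDl. Qed.

Lemma chain_dotNl (R : realType) (n : nat) (s r : chain1 R n) :
  chain_dot (- s) r = - chain_dot s r.
Proof. by rewrite /chain_dot -sumrN; apply: eq_bigr => e _; rewrite ffunE mulNr. Qed.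

Lemma chain_dot_nbr (R : realType) (n : nat) (v : vertex n) (k : 'I_3) (r : chain1 R n) :
  (2 < n)%N -> chain_dot (edge_chain R v (nbr v k)) r = r (v, k).
Proof.
move=> n2; rewrite edge_chain_nbr // /chain_dot (bigD1 (v, k)) //= ffunE eqxx mul1r.
by rewrite big1 ?addr0 // => e /negbTE ne; rewrite ffunE ne mul0r.
Qed.

(** The chain representing [<., phi>] for the inner product, so that jumps and rates are both values
    of [chain_dot]. *)
Definition integral_chain (R : realType) (n : nat) (phi : form1 R) : chain1 R n :=
  [ffun e => edge_integral e phi].

Lemma pairingE (R : realType) (n : nat) (s : chain1 R n) (phi : form1 R) :
  pairing s phi = chain_dot s (integral_chain n phi).
Proof. by apply: eq_bigr => e _; rewrite ffunE. Qed.

Lemma chain_dot_bd2_up (R : realType) (n : nat) (v : vertex n) (r : chain1 R n) :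
  (2 < n)%N -> chain_dot (bd2 R (v, true, true)) r =
    r (v, dir0) - r (v, dir1) + r (nbr v dir0, dir2).
Proof.
move=> n2; rewrite /bd2 /= -/dir0 -/dir1 !(chain_dotDl, chain_dotNl).
by rewrite !chain_dot_nbr // -nbr02 chain_dot_nbr //; ring.
Qed.

Lemma chain_dot_bd2_down (R : realType) (n : nat) (v : vertex n) (r : chain1 R n) :
  (2 < n)%N -> chain_dot (bd2 R (v, false, true)) r =
    r (v, dir1) - r (v, dir2) - r (nbr v dir2, dir0).
Proof.
move=> n2; rewrite /bd2 /= -/dir1 -/dir2 !(chain_dotDl, chain_dotNl).
rewrite [edge_chain R (nbr v dir1) _]edge_chainC chain_dotNl.
by rewrite !chain_dot_nbr // -nbr20 chain_dot_nbr //; ring.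
Qed.

Lemma bd2N (R : realType) (n : nat) (t : triangle n) : bd2 R (t, false) = - bd2 R (t, true).
Proof.
case: t => v b; rewrite /bd2 /= [edge_chain R (nbr v _) _]edge_chainC.
by rewrite !opprD !opprK addrAC.
Qed.

(* The two orientations of a triangle jump in opposite directions, and
   [max x 0 - max (- x) 0 = x]. *)
Lemma generator_pairing (R : realType) (n : nat) (phi : form1 R) (s : chain1 R n) :
  generator (fun r => pairing r phi) s =
  - epsn R n ^- 2 * \sum_(t : triangle n)
     chain_dot (bd2 R (t, true)) (integral_chain n phi) * chain_dot (bd2 R (t, true)) s.
Proof.
rewrite /generator mulNr -mulrN; congr (_ * _).
have jump (b : chain1 R n) :
    pairing (s - b) phi - pairing s phi = - chain_dot b (integral_chain n phi).
  by rewrite !pairingE chain_dotDl chain_dotNl addrAC subrr add0r.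
have -> : \sum_(t : otriangle n)
     (pairing (s - bd2 R t) phi - pairing s phi) * jump_rate s (bd2 R t)
  = \sum_(t : triangle n) \sum_(o : bool)
     (pairing (s - bd2 R (t, o)) phi - pairing s phi) * jump_rate s (bd2 R (t, o)).
  by rewrite pair_bigA /=; under [RHS]eq_bigr => p _ do rewrite -surjective_pairing.
rewrite -[RHS]sumrN; apply: eq_bigr => t _.
rewrite big_bool /= !jump /jump_rate bd2N !chain_dotNl opprK.
move: (chain_dot _ _) (chain_dot _ s) => x y.
have [y0|/ltW y0] := leP y 0.
  by rewrite (@max_l _ _ (- y)) ?oppr_ge0 //; ring.
by rewrite (@max_r _ _ (- y)) ?oppr_le0 //; ring.
Qed.

Lemma sum_edge (R : realType) (n : nat) (F : edge n -> R) :
  \sum_(e : edge n) F e =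
  \sum_(v : vertex n) (F (v, dir0) + F (v, dir1) + F (v, dir2)).
Proof.
transitivity (\sum_(v : vertex n) \sum_(k < 3) F (v, k)).
  by rewrite pair_bigA /=; under [RHS]eq_bigr => p _ do rewrite -surjective_pairing.
apply: eq_bigr => v _; rewrite !big_ord_recl big_ord0 addr0 addrA.
by congr (F (_, _) + F (_, _) + F (_, _)); apply: val_inj; rewrite /= inordK.
Qed.

Lemma sum_triangle (R : realType) (n : nat) (F : triangle n -> R) :
  \sum_(t : triangle n) F t = \sum_(v : vertex n) (F (v, true) + F (v, false)).
Proof.
transitivity (\sum_(v : vertex n) \sum_(b : bool) F (v, b)).
  by rewrite pair_bigA /=; under [RHS]eq_bigr => p _ do rewrite -surjective_pairing.
by apply: eq_bigr => v _; rewrite big_bool.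
Qed.

Lemma vpos_nbr (R : realType) (n : nat) (v : vertex n) (k : 'I_3) : ~~ odd n ->
  exists a b : int, vpos R (nbr v k) =
    vpos R v + edge_vec R n k + (a%:~R * 2, b%:~R * Num.sqrt 3).
Proof.
move=> en; have [a [b /= E]] := vpos_tgt R (v, k) en.
exists (- a), (- b); rewrite E -[LHS]addr0 -addrA; congr (_ + _).
by rewrite -[LHS]/(0, 0); congr pair => /=; rewrite mulrNz mulNr subrr.
Qed.

Definition lattice_periodic (R : realType) (E : R * R -> R * R -> R) :=
  forall (p h : R * R) (a b : int), E (p + (a%:~R * 2, b%:~R * Num.sqrt 3)) h = E p h.

Lemma up_bd_periodic (R : realType) (e s : R) (E : R * R -> R * R -> R) (x y : R) (a b : int) :
  lattice_periodic E ->
  up_bd e s E (x + a%:~R * 2, y + b%:~R * Num.sqrt 3) = up_bd e s E (x, y).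
Proof.
move=> pE.
have H x' y' h : E (x' + a%:~R * 2, y' + b%:~R * Num.sqrt 3) h = E (x', y') h.
  exact: (pE (x', y')).
by rewrite /up_bd /= [x + _ + 2 * e]addrAC !H.
Qed.

Lemma down_bd_periodic (R : realType) (e s : R) (E : R * R -> R * R -> R) (x y : R) (a b : int) :
  lattice_periodic E ->
  down_bd e s E (x + a%:~R * 2, y + b%:~R * Num.sqrt 3) = down_bd e s E (x, y).
Proof.
move=> pE.
have H x' y' h : E (x' + a%:~R * 2, y' + b%:~R * Num.sqrt 3) h = E (x', y') h.
  exact: (pE (x', y')).
by rewrite /down_bd /= [x + _ - e]addrAC [y + _ + s * e]addrAC !H.
Qed.

Lemma edge_vec_dir (R : realType) (n : nat) (k : 'I_3) :
  edge_vec R n k = dir (epsn R n) (Num.sqrt 3) k.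
Proof. by case: k => -[|[|[]]]. Qed.

(** Summation by parts: each edge collects the boundary integrals of its two adjacent triangles,
    with opposite signs. Evenness of [n] lets the vertices be replaced by points of the plane modulo
    periods. *)
Lemma generator_edges (R : realType) (n : nat) (phi : form1 R) (s : chain1 R n) :
  (2 < n)%N -> ~~ odd n -> periodic phi.1 -> periodic phi.2 ->
  generator (fun r => pairing r phi) s =
  - epsn R n ^- 2 * \sum_(e : edge n)
     s e * bd_jump (epsn R n) (Num.sqrt 3) (fun q h => seg q h phi) e.2 (vpos R e.1).
Proof.
move=> n2 en p1 p2; rewrite generator_pairing; congr (_ * _).
rewrite sum_triangle sum_edge.
set E := fun q h => seg q h phi.
set e := epsn R n; set s3 : R := Num.sqrt 3.
have pE : lattice_periodic E by move=> p h a b; rewrite /E seg_periodic.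
have val0 : dir0 = 0%N :> nat by rewrite inordK.
have val1 : dir1 = 1%N :> nat by rewrite inordK.
have val2 : dir2 = 2%N :> nat by rewrite inordK.
have IE (v : vertex n) k : integral_chain n phi (v, k) = E (vpos R v) (dir e s3 k).
  by rewrite ffunE edge_integralE /src -edge_vec_dir.
have IN (v : vertex n) k j : integral_chain n phi (nbr v k, j)
    = E (vpos R v + dir e s3 k) (dir e s3 j).
  by rewrite IE -edge_vec_dir; have [a [b ->]] := vpos_nbr R v k en; rewrite pE.
have U (v : vertex n) : chain_dot (bd2 R (v, true, true)) (integral_chain n phi)
    = up_bd e s3 E (vpos R v).
  rewrite chain_dot_bd2_up // !(IN, IE) val0 val1 val2 /up_bd.
  by case: (vpos R v) => x y; rewrite -[(x, y) + _]/(x + 2 * e, y + 0) addr0.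
have D (v : vertex n) : chain_dot (bd2 R (v, false, true)) (integral_chain n phi)
    = down_bd e s3 E (vpos R v).
  by rewrite chain_dot_bd2_down // !(IN, IE) val0 val1 val2 /down_bd.
(* Of the sides of the triangles at [v], only one per triangle starts at another vertex. [U0] and
   [D2] express the triangle from that vertex, which makes the reindexing by [nbr] possible. *)
have U0 (v : vertex n) : up_bd e s3 E (vpos R v)
    = up_bd e s3 E ((vpos R (nbr v dir0)).1 - 2 * e, (vpos R (nbr v dir0)).2).
  have [a [b ->]] := vpos_nbr R v dir0 en; rewrite edge_vec_dir val0.
  case: (vpos R v) => x y; rewrite -(up_bd_periodic e s3 x y a b pE).
  rewrite -[RHS]/(up_bd e s3 E (x + 2 * e + a%:~R * 2 - 2 * e, y + 0 + b%:~R * s3)).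
  by rewrite addr0 [x + _ + _]addrAC addrK.
have D2 (v : vertex n) : down_bd e s3 E (vpos R v)
    = down_bd e s3 E ((vpos R (nbr v dir2)).1 + e, (vpos R (nbr v dir2)).2 - s3 * e).
  have [a [b ->]] := vpos_nbr R v dir2 en; rewrite edge_vec_dir val2.
  case: (vpos R v) => x y; rewrite -(down_bd_periodic e s3 x y a b pE).
  rewrite -[RHS]/(down_bd e s3 E (x - e + a%:~R * 2 + e, y + s3 * e + b%:~R * s3 - s3 * e)).
  by rewrite [x - e + _]addrAC subrK [y + _ + _]addrAC addrK.
pose G0 v := up_bd e s3 E ((vpos R v).1 - 2 * e, (vpos R v).2) * s (v, dir2).
pose G2 v := down_bd e s3 E ((vpos R v).1 + e, (vpos R v).2 - s3 * e) * s (v, dir0).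
transitivity (\sum_(v : vertex n) (up_bd e s3 E (vpos R v) * (s (v, dir0) - s (v, dir1))
   + down_bd e s3 E (vpos R v) * (s (v, dir1) - s (v, dir2))
   + G0 (nbr v dir0) - G2 (nbr v dir2))).
  apply: eq_bigr => v _; rewrite (U v) (D v) (chain_dot_bd2_up v s n2) (chain_dot_bd2_down v s n2).
  rewrite /G0 /G2 -U0 -D2; move: (up_bd e s3 E _) (down_bd e s3 E _).
  move: (s (v, dir0)) (s (v, dir1)) (s (v, dir2)) (s (nbr v dir0, dir2)) (s (nbr v dir2, dir0)).
  move=> *; ring.
have R0 : \sum_v G0 (nbr v dir0) = \sum_v G0 v.
  by rewrite [RHS](reindex _ (onW_bij _ (nbr0_bij n))).
have R2 : \sum_v G2 (nbr v dir2) = \sum_v G2 v.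
  by rewrite [RHS](reindex _ (onW_bij _ (nbr2_bij n))).
rewrite sumrB big_split /= R0 R2 -big_split -sumrB /=.
apply: eq_bigr => v _; rewrite val0 val1 val2 /G0 /G2 /bd_jump.
move: (up_bd e s3 E (vpos R v)) (up_bd e s3 E (_, _)) (down_bd e s3 E (vpos R v)).
move: (down_bd e s3 E (_, _)) (s (v, dir0)) (s (v, dir1)) (s (v, dir2)) => *; ring.
Qed.

(** * A form with prescribed integrals over the edges *)

Lemma continuous_max0 (R : realType) : continuous (fun x : R => Num.max x 0).
Proof.
move=> x; apply: (@continuous_max _ _ (fun y : R => y) (fun=> 0)).
  exact: cvg_id.
exact: cvg_cst.
Qed.

Lemma is_derive_sqr_max0 (R : realType) (t : R) :
  is_derive t 1 (fun x : R => Num.max x 0 ^+ 2) (2 * Num.max t 0).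
Proof.
have [t0|t0|->] := ltgtP t 0.
- rewrite mulr0; apply: (@near_eq_is_derive _ _ _ (cst 0)).
  near=> x; rewrite /= (@max_r _ _ x 0) ?expr0n //; apply: ltW; near: x.
  exact: lt_nbhsl.
- have dx : is_derive t 1 ((id : R -> R) ^+ 2) (2 * t).
    by apply: is_derive_eq; rewrite expr1 -[_ *: _]/(_ * _) mulr1.
  apply: near_eq_is_derive dx.
  near=> x; rewrite exprfctE /= (@max_l _ _ x 0) //; apply: ltW; near: x.
  exact: lt_nbhsr.
- rewrite mulr0.
  (* At 0 the difference quotient of the squared positive part is the positive part itself. *)
  have cv : (fun h : R => h^-1 *: (((fun x : R => Num.max x 0 ^+ 2) \o shift 0) (h *: 1)
        - Num.max 0 0 ^+ 2)) @ 0^' --> (0 : R).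
    have c0 : (fun h : R => Num.max h 0) @ 0^' --> (0 : R).
      have : (fun h : R => Num.max h 0) @ 0^' --> Num.max (0 : R) 0.
        by apply: cvg_within_filter; exact: continuous_max0.
      by rewrite maxxx.
    apply: cvg_trans c0; apply: near_eq_cvg; near=> h.
    have h0 : h != 0 by near: h; exact: nbhs_dnbhs_neq.
    rewrite /= maxxx expr0n /= subr0 addr0 -[h *: 1]/(h * 1) mulr1 -[_ *: _]/(_ * _).
    have [hn|hp] := leP h 0; first by rewrite expr0n /= mulr0.
    by rewrite expr2 mulKf.
  by split; [apply/cvg_ex; exists 0; exact: cv|exact: cvg_lim cv].
Unshelve. all: by end_near. Qed.

(** Squaring the positive part makes the function C^1 across 0 and 1, which is all the regularity
    that [flat_norm_dual] asks for. *)
Definition bump (R : realType) (t : R) : R := Num.max (t * (1 - t)) 0 ^+ 2.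
Definition bump' (R : realType) (t : R) : R := 2 * Num.max (t * (1 - t)) 0 * (1 - 2 * t).

Lemma is_derive_bump (R : realType) (t : R) : is_derive t 1 (@bump R) (bump' t).
Proof.
have dq : is_derive t 1 (fun x : R => x * (1 - x)) (1 - 2 * t).
  apply: is_derive_eq; rewrite -![_ *: _]/(_ * _); ring.
rewrite /bump'.
exact: (@is_derive1_comp _ (fun x : R => Num.max x 0 ^+ 2) (fun x : R => x * (1 - x))
  t _ _ (is_derive_sqr_max0 _) dq).
Qed.

Lemma continuous_bump (R : realType) : continuous (@bump R).
Proof.
move=> t; apply/differentiable_continuous/derivable1_diffP.
by have [] := is_derive_bump t.
Qed.

Lemma continuous_bump' (R : realType) : continuous (@bump' R).
Proof.
have cq : continuous (fun t : R => t * (1 - t)).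
  move=> t; apply: cvgM; first exact: cvg_id.
  by apply: cvgB; [exact: cvg_cst|exact: cvg_id].
move=> t; apply: cvgM; [apply: cvgM; first exact: cvg_cst|].
  apply: (continuous_comp (f := fun t : R => t * (1 - t)) (g := fun x : R => Num.max x 0)).
    exact: cq.
  exact: continuous_max0.
apply: cvgB; first exact: cvg_cst.
by apply: cvgM; [exact: cvg_cst|exact: cvg_id].
Qed.

(** The endpoints are included, so that at an integer it is irrelevant which unit interval [floor]
    selects. *)
Definition supp01 (R : realType) (f : R -> R) : Prop :=
  forall t, (t <= 0) || (1 <= t) -> f t = 0.

Lemma max_bump0 (R : realType) (t : R) :
  (t <= 0) || (1 <= t) -> Num.max (t * (1 - t)) 0 = 0.
Proof. by move=> /orP[t0|t1]; apply: max_r; nra. Qed.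

Lemma supp01_bump (R : realType) : supp01 (@bump R).
Proof. by move=> t t01; rewrite /bump max_bump0 // expr0n. Qed.

Lemma supp01_bump' (R : realType) : supp01 (@bump' R).
Proof. by move=> t t01; rewrite /bump' max_bump0 // mulr0 mul0r. Qed.

Lemma bump_in01 (R : realType) (t : R) : 0 <= t <= 1 -> bump t = (t * (1 - t)) ^+ 2.
Proof. by move=> /andP[t0 t1]; rewrite /bump max_l // mulr_ge0 // subr_ge0. Qed.

Lemma bump_bound (R : realType) (t : R) : `|bump t| <= 1.
Proof.
have [t01|] := boolP ((t <= 0) || (1 <= t)); first by rewrite supp01_bump // normr0.
rewrite negb_or -!ltNge => /andP[t0 t1]; rewrite bump_in01 ?(ltW t0) ?(ltW t1) //.
have : 0 <= t * (1 - t) <= 1 by apply/andP; split; nra.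
by move=> /andP[a0 a1]; rewrite ger0_norm ?exprn_ge0 // expr2 mulr_ile1.
Qed.

Lemma bump'_bound (R : realType) (t : R) : `|bump' t| <= 1.
Proof.
have [t01|] := boolP ((t <= 0) || (1 <= t)); first by rewrite supp01_bump' // normr0.
rewrite negb_or -!ltNge => /andP[t0 t1]; rewrite /bump'.
rewrite max_l ?mulr_ge0 ?subr_ge0 ?(ltW t0) ?(ltW t1) //.
have a0 : 0 <= t * (1 - t) by rewrite mulr_ge0 ?subr_ge0 ?(ltW t0) ?(ltW t1).
have a1 : 2 * (t * (1 - t)) <= 1 by have := sqr_ge0 (2 * t - 1); rewrite expr2; lra.
rewrite normrM; apply: mulr_ile1 => //; last by rewrite ler_norml; apply/andP; split; lra.
by rewrite ger0_norm // mulr_ge0.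
Qed.

Lemma bumpC (R : realType) (t : R) : bump (1 - t) = bump t.
Proof. by rewrite /bump subKr mulrC. Qed.

(** * Weighted bumps on the unit cells of a pair of linear coordinates *)

Definition lin (R : realType) (al p : R * R) : R := al.1 * p.1 + al.2 * p.2.

Lemma linD (R : realType) (al p q : R * R) : lin al (p + q) = lin al p + lin al q.
Proof.
case: p q => p1 p2 [q1 q2]; rewrite -[LHS]/(al.1 * (p1 + q1) + al.2 * (p2 + q2)).
by rewrite /lin /=; ring.
Qed.

Lemma linZ (R : realType) (al p : R * R) (c : R) : lin al (c *: p) = c * lin al p.
Proof.
case: p => p1 p2; rewrite -[LHS]/(al.1 * (c * p1) + al.2 * (c * p2)).
by rewrite /lin /=; ring.
Qed.

Lemma continuous_lin (R : realType) (al : R * R) : continuous (lin al).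
Proof.
move=> p; apply: cvgD; apply: cvgM; try exact: cvg_cst.
  exact: cvg_fst.
exact: cvg_snd.
Qed.

Lemma is_derive_lin (R : realType) (f : R -> R) (al p w : R * R) (c d : R) :
  is_derive (lin al p + c) 1 f d ->
  is_derive p w (fun q => f (lin al q + c)) (lin al w * d).
Proof.
move=> df.
have dg : is_derive (0 : R) 1 (fun h : R => h * lin al w + (lin al p + c)) (lin al w).
  apply: is_derive_eq; rewrite -![_ *: _]/(_ * _); ring.
have df' : is_derive (0 * lin al w + (lin al p + c)) 1 f d by rewrite mul0r add0r.
have := @is_derive1_comp _ f (fun h : R => h * lin al w + (lin al p + c)) 0 _ _ df' dg.
rewrite mulrC => -[].
rewrite /derivable /derive => ex <-.
have E : (fun h : R => h^-1 *: (((fun q => f (lin al q + c)) \o shift p) (h *: w)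
           - f (lin al p + c))) =
         (fun h : R => h^-1 *: (((f \o (fun h : R => h * lin al w + (lin al p + c))) \o shift 0)
           (h *: 1) - (f \o (fun h : R => h * lin al w + (lin al p + c))) 0)).
  apply/funext => h; rewrite /= linD linZ addr0 -[h *: 1]/(h * 1) mulr1 mul0r add0r.
  by rewrite (addrA (h * lin al w) (lin al p) c).
by split; rewrite /derivable /derive E.
Qed.

(** For [f] and [g] supported in the unit interval this is the sum over all integers k, l of rho k l
    f(u - k) g(v - l); the floors select the only term that can be nonzero. *)
Definition cell (R : realType) (rho : int -> int -> R) (f g : R -> R) (u v : R) : R :=
  rho (Num.floor u) (Num.floor v) *
  (f (u - (Num.floor u)%:~R) * g (v - (Num.floor v)%:~R)).

Lemma supp01_floor (R : realType) (f : R -> R) (u : R) (k : int) :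
  supp01 f -> k != Num.floor u -> f (u - k%:~R) = 0.
Proof.
move=> sf ku; apply: sf; have /andP[u0 u1] := floor_itv u; apply/orP.
have [kl|kl] := ltP k (Num.floor u); [right|left].
  have : (k + 1)%:~R <= (Num.floor u)%:~R :> R by rewrite ler_int lezD1.
  by rewrite intrD; lra.
have : (Num.floor u + 1)%:~R <= k%:~R :> R by rewrite ler_int lezD1 lt_neqAle eq_sym ku.
lra.
Qed.

Lemma floor_near (R : realType) (u u0 : R) : `|u - u0| < 1 ->
  exists i : 'I_3, Num.floor u = Num.floor u0 - 1 + i%:Z.
Proof.
rewrite ltr_norml => /andP[l1 l2].
have h : (Num.floor u0 - 1 <= Num.floor u <= Num.floor u0 + 1)%R.
  have /andP[a0 a1] := floor_itv u0; have /andP[b0 b1] := floor_itv u.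
  rewrite !intrD in a1 b1; rewrite -!ltzD1 -!(ltr_int R) !(intrD, mulrNz).
  by apply/andP; split; lra.
have hi : (absz (Num.floor u - (Num.floor u0 - 1))%R < 3)%N by lia.
by exists (Ordinal hi) => /=; lia.
Qed.

(** Near a point the floors are traded for a sum over nine fixed cells, which can be handled term by
    term for continuity and derivatives. *)
Lemma cell_local (R : realType) (rho : int -> int -> R) (f g : R -> R) (u v u0 v0 : R) :
  supp01 f -> supp01 g -> `|u - u0| < 1 -> `|v - v0| < 1 ->
  cell rho f g u v = \sum_(i < 3) \sum_(j < 3)
    (let k := Num.floor u0 - 1 + i%:Z in let l := Num.floor v0 - 1 + j%:Z in
     rho k l * (f (u - k%:~R) * g (v - l%:~R))).
Proof.
move=> sf sg /floor_near[i iE] /floor_near[j jE].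
have shiftE (a : int) (i1 j1 : 'I_3) : (a + i1%:Z == a + j1%:Z) = (i1 == j1).
  by rewrite (inj_eq (addrI _)) eqz_nat.
rewrite (bigD1 i) //= (bigD1 j) //= -iE -jE.
rewrite big1 ?addr0 => [|j' jj']; last first.
  by rewrite (supp01_floor sg) ?mulr0 // jE shiftE.
rewrite big1 ?addr0 // => i' ii'; rewrite big1 // => j' _.
by rewrite (supp01_floor sf) ?mul0r ?mulr0 // iE shiftE.
Qed.

Lemma cell_local_near (R : realType) (rho : int -> int -> R) (f g : R -> R)
    (al be p0 : R * R) : supp01 f -> supp01 g ->
  \forall p \near p0, \sum_(i < 3) \sum_(j < 3)
    (let k := Num.floor (lin al p0) - 1 + i%:Z in
     let l := Num.floor (lin be p0) - 1 + j%:Z in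
     rho k l * (f (lin al p - k%:~R) * g (lin be p - l%:~R)))
  = cell rho f g (lin al p) (lin be p).
Proof.
move=> sf sg.
have near1 ga : \forall p \near p0, `|lin ga p - lin ga p0| < 1.
  have /cvgrPdist_lt /(_ 1 ltr01) := @continuous_lin R ga p0.
  by apply: filterS => p; rewrite distrC.
near=> p; rewrite (@cell_local _ _ _ _ _ _ (lin al p0) (lin be p0)) //.
  by near: p; exact: near1.
by near: p; exact: near1.
Unshelve. all: by end_near. Qed.

Lemma continuous_sum_ord (R : realType) (T : topologicalType) (n : nat)
    (F : 'I_n -> T -> R) (x : T) :
  (forall i, {for x, continuous (F i)}) -> {for x, continuous (fun y => \sum_(i < n) F i y)}.
Proof.
elim: n F => [|n IH] F cF.
  have -> : (fun y => \sum_(i < 0) F i y) = fun=> 0 by apply/funext => y; rewrite big_ord0.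
  exact: cvg_cst.
have -> : (fun y => \sum_(i < n.+1) F i y)
    = (fun y => \sum_(i < n) F (widen_ord (leqnSn n) i) y + F ord_max y).
  by apply/funext => y; rewrite big_ord_recr.
by apply: cvgD; [apply: (IH (fun i => F (widen_ord _ i)))|]; move=> *; exact: cF.
Qed.

Lemma near_eq_continuous (T U : topologicalType) (F G : T -> U) (x : T) :
  (\forall y \near x, F y = G y) -> {for x, continuous F} -> {for x, continuous G}.
Proof.
move=> FG; have FGx : F x = G x by exact: (nbhs_singleton FG).
rewrite /prop_for /continuous_at -FGx; apply: cvg_trans; apply: near_eq_cvg.
by apply: filterS FG => y ->.
Qed.

Lemma continuous_cell (R : realType) (rho : int -> int -> R) (f g : R -> R)
    (al be : R * R) : supp01 f -> supp01 g -> continuous f -> continuous g ->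
  continuous (fun p => cell rho f g (lin al p) (lin be p)).
Proof.
move=> sf sg cf cg p0.
have cl (h : R -> R) ga (c : R) : continuous h -> {for p0, continuous (fun p => h (lin ga p - c))}.
  move=> ch; apply: (continuous_comp (f := fun p => lin ga p - c) (g := h)); last exact: ch.
  by apply: cvgB; [exact: continuous_lin|exact: cvg_cst].
have near_eq := cell_local_near rho al be p0 sf sg.
apply: (near_eq_continuous near_eq).
apply: (@continuous_sum_ord R _ 3 (fun i p => \sum_(j < 3) _)) => i.
apply: (@continuous_sum_ord R _ 3 (fun j p => _)) => j.
by apply: cvgM; [exact: cvg_cst|apply: cvgM; exact: cl].
Qed.

Lemma is_derive_sum_fun (R : realType) (n : nat) (F : 'I_n -> R * R -> R)
    (dF : 'I_n -> R) (p w : R * R) :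
  (forall i, is_derive p w (F i) (dF i)) ->
  is_derive p w (fun q => \sum_(i < n) F i q) (\sum_(i < n) dF i).
Proof.
move=> FdF; have -> : (fun q => \sum_(i < n) F i q) = \sum_(i < n) F i.
  by apply/funext => q; rewrite fct_sumE.
exact: is_derive_sum.
Qed.

Lemma is_derive_cell (R : realType) (rho : int -> int -> R) (f g f' g' : R -> R)
    (al be w p0 : R * R) :
  supp01 f -> supp01 g -> supp01 f' -> supp01 g' ->
  (forall t : R, is_derive t 1 f (f' t)) -> (forall t : R, is_derive t 1 g (g' t)) ->
  is_derive p0 w (fun p => cell rho f g (lin al p) (lin be p))
    (lin al w * cell rho f' g (lin al p0) (lin be p0)
     + lin be w * cell rho f g' (lin al p0) (lin be p0)).
Proof.
move=> sf sg sf' sg' df dg.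
apply: (near_eq_is_derive (cell_local_near rho al be p0 sf sg)).
(* The cells in the claimed derivative are expanded over the same nine cells, where the product rule
   applies. *)
rewrite -(nbhs_singleton (cell_local_near rho al be p0 sf' sg)).
rewrite -(nbhs_singleton (cell_local_near rho al be p0 sf sg')).
rewrite !mulr_sumr -big_split /=.
apply: (@is_derive_sum_fun _ 3 (fun i p => \sum_(j < 3) _)) => i; rewrite !mulr_sumr -big_split /=.
apply: (@is_derive_sum_fun _ 3 (fun j p => _)) => j.
set k := Num.floor (lin al p0) - 1 + i%:Z; set l := Num.floor (lin be p0) - 1 + j%:Z.
have Df := is_derive_lin w (df (lin al p0 - k%:~R)).
have Dg := is_derive_lin w (dg (lin be p0 - l%:~R)).
have := is_deriveZ (rho k l) (is_deriveM Df Dg).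
move=> D; apply: (is_derive_eq D).
rewrite -![_ *: _]/(_ * _); ring.
Qed.

Lemma cell_bound (R : realType) (rho : int -> int -> R) (f g : R -> R) (u v D : R) :
  (forall i j, `|rho i j| <= D) -> (forall t, `|f t| <= 1) -> (forall t, `|g t| <= 1) ->
  `|cell rho f g u v| <= D.
Proof.
move=> rD f1 g1; have D0 : 0 <= D by apply: le_trans (rD 0 0).
by rewrite /cell !normrM -[leRHS]mulr1 ler_pM // mulr_ile1.
Qed.

Lemma cell_shift (R : realType) (rho : int -> int -> R) (f g : R -> R) (u v : R) (a b : int) :
  (forall i j, rho (i + a) (j + b) = rho i j) ->
  cell rho f g (u + a%:~R) (v + b%:~R) = cell rho f g u v.
Proof.
move=> rE; have E (x : R) (k c : int) : x + c%:~R - (k + c)%:~R = x - k%:~R.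
  by rewrite intrD opprD addrACA subrr addr0.
by rewrite /cell !floorDrz ?intr_int // !intrKfloor rE !E.
Qed.

Lemma cell_diag (R : realType) (rho : int -> int -> R) (f g : R -> R) (i j : int) (t t' : R) :
  supp01 f -> supp01 g -> 0 <= t <= 1 -> 0 <= t' <= 1 ->
  cell rho f g (i%:~R + t) (j%:~R + t') = rho i j * (f t * g t').
Proof.
move=> sf sg /andP[t0 t1] /andP[t'0 t'1].
have floorE (k : int) (x : R) : 0 <= x -> x < 1 -> Num.floor (k%:~R + x) = k.
  move=> x0 x1; apply: floor_def; rewrite intrD; apply/andP; split; lra.
have floor1 (k : int) : Num.floor (k%:~R + 1 : R) = k + 1.
  by rewrite -[1]/(1%:~R) -intrD intrKfloor.
have f0 : f 0 = 0 by rewrite sf ?lexx.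
have g0 : g 0 = 0 by rewrite sg ?lexx.
have f1 : f 1 = 0 by rewrite sf // lexx orbT.
have g1 : g 1 = 0 by rewrite sg // lexx orbT.
(* At 1 the floor jumps to the next cell, but both sides vanish there. *)
move: t1; rewrite le_eqVlt => /orP[/eqP ->|t1].
  by rewrite /cell floor1 intrD subrr f0 f1 !mul0r !mulr0.
move: t'1; rewrite le_eqVlt => /orP[/eqP ->|t'1].
  by rewrite /cell floor1 intrD subrr g0 g1 !mulr0.
by rewrite /cell !floorE // !(addrC _%:~R) !addrK.
Qed.

(** Vanishing on the grid lines is what hides the bumps of one direction from the edges in the other
    directions. *)
Lemma cell_intl (R : realType) (rho : int -> int -> R) (f g : R -> R) (i : int) (v : R) :
  supp01 f -> cell rho f g i%:~R v = 0.
Proof. by move=> sf; rewrite /cell intrKfloor subrr sf ?lexx // mul0r mulr0. Qed.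

Lemma cell_intr (R : realType) (rho : int -> int -> R) (f g : R -> R) (u : R) (j : int) :
  supp01 g -> cell rho f g u j%:~R = 0.
Proof. by move=> sg; rewrite /cell intrKfloor subrr sg ?lexx // !mulr0. Qed.

Definition comb3 (R : realType) (a b c : R) (f g h : R * R -> R) : R * R -> R :=
  fun p => a * f p + b * g p + c * h p.

Lemma is_derive_comb3 (R : realType) (a b c : R) (f g h : R * R -> R) (p w : R * R)
    (df dg dh : R) :
  is_derive p w f df -> is_derive p w g dg -> is_derive p w h dh ->
  is_derive p w (comb3 a b c f g h) (a * df + b * dg + c * dh).
Proof.
move=> Df Dg Dh.
exact: (is_deriveD (is_deriveD (is_deriveZ a Df) (is_deriveZ b Dg)) (is_deriveZ c Dh)).
Qed.

Lemma continuous_comb3 (R : realType) (a b c : R) (f g h : R * R -> R) :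
  continuous f -> continuous g -> continuous h -> continuous (comb3 a b c f g h).
Proof.
move=> cf cg ch p; apply: cvgD; first apply: cvgD.
- by apply: cvgM; [exact: cvg_cst|exact: cf].
- by apply: cvgM; [exact: cvg_cst|exact: cg].
- by apply: cvgM; [exact: cvg_cst|exact: ch].
Qed.

Lemma class_C1_comb3 (R : realType) (a b c : R) (f g h : R * R -> R) :
  class_C 1 f -> class_C 1 g -> class_C 1 h ->
  class_C 1 (comb3 a b c f g h) /\
  (forall p w, is_axis w -> 'D_w (comb3 a b c f g h) p
     = a * 'D_w f p + b * 'D_w g p + c * 'D_w h p).
Proof.
move=> Cf Cg Ch.
have D p w : is_axis w -> is_derive p w (comb3 a b c f g h)
    (a * 'D_w f p + b * 'D_w g p + c * 'D_w h p).
  move=> aw; apply: is_derive_comb3; apply/derivableP.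
  - by case: (class_C_derive aw Cf).
  - by case: (class_C_derive aw Cg).
  - by case: (class_C_derive aw Ch).
have DE p w : is_axis w -> 'D_w (comb3 a b c f g h) p
     = a * 'D_w f p + b * 'D_w g p + c * 'D_w h p by move=> /(D p)[].
split=> //.
have cD w : is_axis w -> continuous ('D_w (comb3 a b c f g h)).
  move=> aw; have -> : 'D_w (comb3 a b c f g h) = comb3 a b c ('D_w f) ('D_w g) ('D_w h).
    by apply/funext => p; rewrite DE.
  by apply: continuous_comb3; [case: (class_C_derive aw Cf) => -[]|
    case: (class_C_derive aw Cg) => -[]|case: (class_C_derive aw Ch) => -[]].
have a1 : is_axis ((1, 0) : R * R) by left.
have a2 : is_axis ((0, 1) : R * R) by right.
split; first by apply: continuous_comb3; [case: Cf|case: Cg|case: Ch].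
split.
- by move=> p; case: (D p _ a1).
- by move=> p; case: (D p _ a2).
- by split=> //; exact: cD.
- by split=> //; exact: cD.
Qed.

Lemma class_C1_cell (R : realType) (rho : int -> int -> R) (al be : R * R) :
  class_C 1 (fun p => cell rho (@bump R) (@bump R) (lin al p) (lin be p)) /\
  (forall p w, 'D_w (fun p => cell rho (@bump R) (@bump R) (lin al p) (lin be p)) p
     = lin al w * cell rho (@bump' R) (@bump R) (lin al p) (lin be p)
       + lin be w * cell rho (@bump R) (@bump' R) (lin al p) (lin be p)).
Proof.
have sb := @supp01_bump R; have sb' := @supp01_bump' R.
have cb := @continuous_bump R; have cb' := @continuous_bump' R.
have D p w := is_derive_cell rho al be w p sb sb sb' sb' (@is_derive_bump R) (@is_derive_bump R).
have DE p w := @derive_val _ _ _ _ _ _ _ (D p w).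
split=> //.
have cD w : continuous ('D_w (fun p => cell rho (@bump R) (@bump R) (lin al p) (lin be p))).
  rewrite (_ : 'D_w _ = fun p => lin al w * cell rho (@bump' R) (@bump R) (lin al p) (lin be p)
       + lin be w * cell rho (@bump R) (@bump' R) (lin al p) (lin be p)).
    have c1 : continuous (fun p => cell rho (@bump' R) (@bump R) (lin al p) (lin be p)).
      exact: continuous_cell.
    have c2 : continuous (fun p => cell rho (@bump R) (@bump' R) (lin al p) (lin be p)).
      exact: continuous_cell.
    by move=> p; apply: cvgD; (apply: cvgM; first exact: cvg_cst); [exact: c1|exact: c2].
  by apply/funext => p; rewrite DE.
split; first exact: continuous_cell.
split.
- by move=> p; case: (D p (1, 0)).
- by move=> p; case: (D p (0, 1)).
- by split=> //; exact: cD.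
- by split=> //; exact: cD.
Qed.

(** * Lattice coordinates and edge weights *)

Definition lattice_pt (R : realType) (e s : R) (a b : int) : R * R :=
  ((2 * a + b)%:~R * e, b%:~R * (s * e)).

(** On [lattice_pt e s a b], which is a dir0 + b dir1, these take the values a, b and a + b. They
    are constant along directions 1, 0 and 2 respectively. *)
Definition coord (R : realType) (e s : R) (k : nat) : R * R :=
  match k with
  | 0%N => ((2 * e)^-1, - (2 * (s * e))^-1)
  | 1%N => (0, (s * e)^-1)
  | _ => ((2 * e)^-1, (2 * (s * e))^-1)
  end.

(* An edge in direction [k] is a diagonal of a unit parallelogram whose sides are
   parallel to the two other directions; on it the two coordinates [edge_coord k]
   are not constant, each of them being constant and integral on the edges in one
   of the other directions.  [edge_src k i j] is the source of the diagonal of the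
   parallelogram with coordinates in [i, i + 1] and [j, j + 1]. *)
Definition edge_coord (R : realType) (e s : R) (k : nat) : (R * R) * (R * R) :=
  match k with
  | 0%N => (coord e s 0, coord e s 2)
  | 1%N => (coord e s 1, coord e s 2)
  | _ => (coord e s 0, coord e s 1)
  end.

Definition edge_src (R : realType) (e s : R) (k : nat) (i j : int) : R * R :=
  match k with
  | 0%N => lattice_pt e s i (j - i)
  | 1%N => lattice_pt e s (j - i) i
  | _ => lattice_pt e s (i + 1) j
  end.

Definition edge_weight (R : realType) (e s : R) (r : R * R -> R) (k : nat) (p : R * R) : R :=
  cell (fun i j => r (edge_src e s k i j)) (@bump R) (@bump R)
    (lin (edge_coord e s k).1 p) (lin (edge_coord e s k).2 p).

Lemma coord_lattice (R : realType) (e s t : R) (a b : int) (k : nat) :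
  e != 0 -> s != 0 ->
  let p := lattice_pt e s a b + t *: dir e s k in
  [/\ lin (coord e s 0) p = a%:~R + t * (match k with 0%N => 1 | 1%N => 0 | _ => -1 end),
      lin (coord e s 1) p = b%:~R + t * (match k with 0%N => 0 | _ => 1 end) &
      lin (coord e s 2) p = (a + b)%:~R + t * (match k with 0%N => 1 | 1%N => 1 | _ => 0 end)].
Proof.
move=> e0 s0 p; rewrite /p !linD !linZ !intrD.
by case: k p => [|[|k]] p; rewrite /lin /coord /lattice_pt /dir /= !intrD intrM; split;
  field; rewrite ?e0 ?s0.
Qed.

(** On its own diagonal both coordinates sweep a unit interval, hence the square of the bump; on an
    edge of another direction one of them is a constant integer. *)
Lemma edge_weight_edge (R : realType) (e s t : R) (r : R * R -> R) (a b : int) (k k' : nat) :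
  e != 0 -> s != 0 -> 0 <= t <= 1 -> (k < 3)%N -> (k' < 3)%N ->
  edge_weight e s r k' (lattice_pt e s a b + t *: dir e s k) =
  if k' == k then r (lattice_pt e s a b) * bump t ^+ 2 else 0.
Proof.
move=> e0 s0 t01 k3 k'3; have sb := @supp01_bump R.
have t01' : 0 <= 1 - t <= 1 by move: t01 => /andP[? ?]; apply/andP; split; lra.
have [] := coord_lattice t a b k e0 s0.
rewrite /edge_weight /edge_coord /edge_src.
move: (lattice_pt e s a b + t *: dir e s k) (coord e s 0) (coord e s 1) (coord e s 2).
move=> p c0 c1 c2.
case: k k3 => [|[|[|//]]] _; case: k' k'3 => [|[|[|//]]] _ /= L0 L1 L2;
  rewrite ?L0 ?L1 ?L2 ?mulr0 ?mulr1 ?addr0 ?(cell_intl _ _ _ _ sb) ?(cell_intr _ _ _ _ sb) //.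
- by rewrite cell_diag // addrAC subrr add0r expr2.
- by rewrite cell_diag // addrK expr2.
(* Direction 2 is the antidiagonal: its first coordinate runs backwards from a to a - 1. This
   explains the i + 1 in [edge_src], and the symmetry of the bump absorbs the reversal. *)
- rewrite (_ : a%:~R + t * -1 = (a - 1)%:~R + (1 - t)); last by rewrite intrD mulrNz; ring.
  by rewrite cell_diag // bumpC subrK expr2.
Qed.

Lemma lattice_ptD (R : realType) (e s : R) (a b c d : int) :
  lattice_pt e s (a + c) (b + d) = lattice_pt e s a b + lattice_pt e s c d.
Proof.
congr pair => /=; last by rewrite intrD mulrDl.
by rewrite -mulrDl -intrD; congr (_%:~R * _); ring.
Qed.

Lemma edge_weight_shift (R : realType) (e s : R) (r : R * R -> R) (a b : int) (k : nat)
    (p : R * R) :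
  e != 0 -> s != 0 -> (forall q, r (q + lattice_pt e s a b) = r q) ->
  edge_weight e s r k (p + lattice_pt e s a b) = edge_weight e s r k p.
Proof.
move=> e0 s0 rP; have := coord_lattice 0 a b 0 e0 s0.
rewrite scale0r addr0 !mul0r !addr0 => -[L0 L1 L2].
rewrite /edge_weight !linD.
rewrite /edge_coord /edge_src; move: (coord e s 0) (coord e s 1) (coord e s 2) L0 L1 L2.
move=> c0 c1 c2 L0 L1 L2; case: k => [|[|k]] /=; rewrite ?L0 ?L1 ?L2;
  apply: cell_shift => i j; rewrite -[RHS]rP -lattice_ptD; congr (r (lattice_pt _ _ _ _)); lia.
Qed.

Lemma coord_bound (R : realType) (e s : R) (k : nat) (w : R * R) :
  0 < e -> 1 <= s -> is_axis w -> `|lin (coord e s k) w| <= e^-1.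
Proof.
move=> e0 s1 aw; have s0 : 0 < s by lra.
have h2 : (2 * e)^-1 <= e^-1 by rewrite lef_pV2 ?posrE ?mulr_gt0 //; lra.
have hs : (s * e)^-1 <= e^-1 by rewrite lef_pV2 ?posrE ?mulr_gt0 // ler_peMl // ltW.
have h2s : (2 * (s * e))^-1 <= e^-1.
  by rewrite lef_pV2 ?posrE ?mulr_gt0 // mulrA ler_peMl ?ltW //; lra.
have p2 : 0 <= (2 * e)^-1 by rewrite invr_ge0 mulr_ge0 ?ltW.
have ps : 0 <= (s * e)^-1 by rewrite invr_ge0 mulr_ge0 ?ltW.
have p2s : 0 <= (2 * (s * e))^-1 by rewrite invr_ge0 mulr_ge0 // mulr_ge0 ?ltW.
have pe : 0 <= e^-1 by rewrite invr_ge0 ltW.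
case: aw => ->; case: k => [|[|k]]; rewrite /lin /coord /= ?mulr1 ?mulr0 ?addr0 ?add0r
  ?normrN ?normr0 // ger0_norm //.
Qed.

Lemma edge_weight_bound (R : realType) (e s D : R) (r : R * R -> R) (k : nat) (p : R * R) :
  (forall q, `|r q| <= D) -> `|edge_weight e s r k p| <= D.
Proof. by move=> rD; apply: cell_bound => // t; exact: bump_bound. Qed.

Lemma edge_weight_C1 (R : realType) (e s D : R) (r : R * R -> R) (k : nat) :
  0 < e -> 1 <= s -> (forall q, `|r q| <= D) ->
  class_C 1 (edge_weight e s r k) /\
  (forall p w, is_axis w -> `|'D_w (edge_weight e s r k) p| <= 2 * (D / e)).
Proof.
move=> e0 s1 rD; have [C1 DE] := class_C1_cell (fun i j => r (edge_src e s k i j))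
  (edge_coord e s k).1 (edge_coord e s k).2.
split=> // p w aw; rewrite /edge_weight DE.
have [l1 l2] : `|lin (edge_coord e s k).1 w| <= e^-1 /\ `|lin (edge_coord e s k).2 w| <= e^-1.
  by case: k {C1 DE} => [|[|k]]; split; exact: coord_bound.
apply: le_trans (ler_normD _ _) _; rewrite mulr_natl mulr2n [D / e]mulrC.
by apply: lerD; rewrite normrM; apply: ler_pM => //; apply: cell_bound => // t;
  (exact: bump_bound || exact: bump'_bound).
Qed.

Lemma eq_int01 (R : realType) (f g : R -> R) :
  (forall t, 0 <= t <= 1 -> f t = g t) -> int01 f = int01 g.
Proof. by move=> fg; apply: eq_Rintegral => t; rewrite inE /= in_itv /= => /fg. Qed.

Lemma int01Z (R : realType) (a : R) (f : R -> R) : continuous f ->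
  int01 (fun t => a * f t) = a * int01 f.
Proof. by move=> cf; rewrite /int01 RintegralZl //; exact: integrable01. Qed.

Section edge_form.
Context (R : realType) (e D : R) (n : nat) (r : nat -> R * R -> R).
Context (e0 : 0 < e) (ne : n%:R * e = 1) (en : ~~ odd n).
Context (rP : forall k, periodic (r k)) (rD : forall k p, `|r k p| <= D).

Let s : R := Num.sqrt 3.
Let W k := edge_weight e s (r k) k.

(** Each weight multiplies the constant covector of its direction. Evaluated on the edge vector this
    yields the squared length 4 e^2, and the squared bump has integral 1 / 630; [m] compensates
    both. *)
Definition edge_form : form1 R :=
  let m := 630 / (4 * e ^+ 2) in let c k := dir e s k in
  (comb3 (m * (c 0%N).1) (m * (c 1%N).1) (m * (c 2%N).1) (W 0) (W 1) (W 2),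
   comb3 (m * (c 0%N).2) (m * (c 1%N).2) (m * (c 2%N).2) (W 0) (W 1) (W 2)).

Let s2 : s ^+ 2 = 3. Proof. by rewrite /s sqr_sqrtr. Qed.
Let s1 : 1 <= s.
Proof. by rewrite -(ler_pXn2r (n := 2)) ?nnegrE ?sqrtr_ge0 // expr1n s2; lra. Qed.
Let sle2 : s <= 2.
Proof. by rewrite -(ler_pXn2r (n := 2)) ?nnegrE ?sqrtr_ge0 // s2; lra. Qed.
Let D0 : 0 <= D. Proof. by apply: le_trans (rD 0 0). Qed.

Lemma edge_weight_periodic (k : nat) : periodic (W k).
Proof.
have e0' : e != 0 by rewrite gt_eqF.
have s0' : s != 0 by rewrite gt_eqF // (lt_le_trans ltr01).
have nN : n%:R = (n./2)%:R * 2 :> R.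
  by rewrite -[in LHS](odd_double_half n) (negbTE en) add0n -muln2 natrM.
(* Both periods of the torus are lattice vectors; the vertical one, n dir1 - (n/2) dir0, needs [n]
   even. *)
have E1 : lattice_pt e s n%:Z 0 = (2, 0).
  by congr pair => /=; rewrite ?mul0r // addr0 intrM -mulrA -pmulrn ne mulr1.
have E2 : lattice_pt e s (- (n./2)%:Z) n%:Z = (0, s).
  congr pair => /=; last by rewrite -pmulrn mulrCA ne mulr1.
  by rewrite intrD intrM mulrNz -!pmulrn nN; ring.
move=> p.
have := @edge_weight_shift R e s (r k) n%:Z 0 k p e0' s0'.
rewrite E1 => H1.
have := @edge_weight_shift R e s (r k) (- (n./2)%:Z) n%:Z k p e0' s0'.
rewrite E2 => H2.
have rS (x y : R) : r k ((x, y) + (2, 0)) = r k (x, y) /\ r k ((x, y) + (0, s)) = r k (x, y).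
  rewrite -[(x, y) + (2, 0)]/(x + 2, y + 0) -[(x, y) + (0, s)]/(x + 0, y + s) !addr0.
  exact: (rP k (x, y)).
case: p H1 H2 => x y H1 H2; split.
  have <- : ((x, y) : R * R) + (2, 0) = (x + 2, y) by congr pair; rewrite /= addr0.
  by apply: H1 => -[x' y']; case: (rS x' y').
have <- : ((x, y) : R * R) + (0, s) = (x, y + s) by congr pair; rewrite /= addr0.
by apply: H2 => -[x' y']; case: (rS x' y').
Qed.

Let W_C1 (k : nat) : class_C 1 (W k).
Proof. by have [] := edge_weight_C1 (r := r k) k e0 s1 (rD k). Qed.

Let W_bound (k : nat) (p : R * R) : `|W k p| <= D.
Proof. exact: edge_weight_bound. Qed.

Let W_derive (k : nat) (p w : R * R) : is_axis w -> `|'D_w (W k) p| <= 2 * (D / e).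
Proof. by have [_] := edge_weight_C1 (r := r k) k e0 s1 (rD k); apply. Qed.

Let coef_bound (k : nat) : `|630 / (4 * e ^+ 2) * (dir e s k).1| <= 315 / e /\
  `|630 / (4 * e ^+ 2) * (dir e s k).2| <= 315 / e.
Proof.
have m0 : 0 <= 630 / (4 * e ^+ 2).
  apply: divr_ge0; [exact: ler0n|apply: mulr_ge0; [exact: ler0n|exact/exprn_ge0/ltW]].
have -> : 315 / e = 630 / (4 * e ^+ 2) * (2 * e) by field; rewrite gt_eqF.
have [] := dir_bound (s := s) k (ltW e0).
  by apply/andP; split; [exact: sqrtr_ge0|exact: sle2].
by move=> h1 h2; rewrite !(normrM (630 / _)) !(ger0_norm m0); split; rewrite ler_wpM2l.
Qed.

Lemma comb3_bound (a0 a1 a2 x0 x1 x2 A X : R) :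
  `|a0| <= A -> `|a1| <= A -> `|a2| <= A -> `|x0| <= X -> `|x1| <= X -> `|x2| <= X ->
  `|a0 * x0 + a1 * x1 + a2 * x2| <= 3 * (A * X).
Proof.
move=> h0 h1 h2 k0 k1 k2.
have b (a x : R) : `|a| <= A -> `|x| <= X -> `|a * x| <= A * X.
  by move=> aA xX; rewrite normrM ler_pM.
have := ler_normD (a0 * x0 + a1 * x1) (a2 * x2); have := ler_normD (a0 * x0) (a1 * x1).
have := b _ _ h0 k0; have := b _ _ h1 k1; have := b _ _ h2 k2; lra.
Qed.

Lemma edge_form_C1 : form1_C 1 edge_form.
Proof.
have pc (a b c : R) : periodic (comb3 a b c (W 0) (W 1) (W 2)).
  move=> p; rewrite /comb3.
  have [-> ->] := edge_weight_periodic 0 p; have [-> ->] := edge_weight_periodic 1 p.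
  by have [-> ->] := edge_weight_periodic 2 p.
by split; [exact: pc|exact: pc| |];
  exact: (proj1 (class_C1_comb3 _ _ _ (W_C1 0) (W_C1 1) (W_C1 2))).
Qed.

Lemma edge_form_bound (p : R * R) :
  `|edge_form.1 p| <= 945 * (D / e) /\ `|edge_form.2 p| <= 945 * (D / e).
Proof.
have E : 945 * (D / e) = 3 * (315 / e * D) by ring.
have [k01 k02] := coef_bound 0; have [k11 k12] := coef_bound 1.
have [k21 k22] := coef_bound 2.
by rewrite E; split; apply: comb3_bound => //; exact: W_bound.
Qed.

(** 3780 is two partial derivatives times three directions, with coefficients at most 315 / e and
    weight derivatives at most 2 D / e. *)
Lemma ext_d1_edge_form_bound (p : R * R) :
  `|ext_d1 edge_form p| <= 3780 * (D / e ^+ 2).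
Proof.
have E : 3780 * (D / e ^+ 2) = 3 * (315 / e * (2 * (D / e))) + 3 * (315 / e * (2 * (D / e))).
  by field; rewrite gt_eqF.
have [k01 k02] := coef_bound 0; have [k11 k12] := coef_bound 1.
have [k21 k22] := coef_bound 2.
have DE (a b c : R) w : is_axis w -> 'D_w (comb3 a b c (W 0) (W 1) (W 2)) p =
    a * 'D_w (W 0) p + b * 'D_w (W 1) p + c * 'D_w (W 2) p.
  by move=> aw; rewrite (proj2 (class_C1_comb3 _ _ _ (W_C1 0) (W_C1 1) (W_C1 2))).
have a1 : is_axis ((1, 0) : R * R) by left.
have a2 : is_axis ((0, 1) : R * R) by right.
rewrite /ext_d1 /d1 /d2 /edge_form [_.1]/= [_.2]/= (DE _ _ _ _ a1) (DE _ _ _ _ a2) E.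
by apply: le_trans (ler_normB _ _) _; apply: lerD; apply: comb3_bound => //; exact: W_derive.
Qed.

Lemma seg_edge_form (k : nat) (a b : int) : (k < 3)%N ->
  seg (lattice_pt e s a b) (dir e s k) edge_form = r k (lattice_pt e s a b).
Proof.
move=> k3; set q := lattice_pt e s a b.
have e0' : e != 0 by rewrite gt_eqF.
have s0' : s != 0 by rewrite gt_eqF // (lt_le_trans ltr01).
have -> : seg q (dir e s k) edge_form = int01 (fun t => (630 * r k q) * bump t ^+ 2).
  apply: eq_int01 => t t01.
  have WE j : (j < 3)%N -> W j (q + t *: dir e s k) = if j == k then r j q * bump t ^+ 2 else 0.
    by move=> j3; rewrite /W edge_weight_edge.
  rewrite /edge_form /comb3; cbv beta iota zeta delta [fst snd]; rewrite !WE //.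
  case: k k3 {WE} => [|[|[|//]]] _ /=.
  - by field.
  (* The factor s^2 is isolated so that it can be replaced by 3 before [field]. *)
  - transitivity (630 / (4 * e ^+ 2) * (e ^+ 2 + s ^+ 2 * e ^+ 2) * r 1 q * bump t ^+ 2).
      by ring.
    by rewrite s2; field.
  - transitivity (630 / (4 * e ^+ 2) * (e ^+ 2 + s ^+ 2 * e ^+ 2) * r 2 q * bump t ^+ 2).
      by ring.
    by rewrite s2; field.
rewrite int01Z.
  rewrite (@eq_int01 _ _ (fun t : R => ((t * (1 - t)) ^+ 2) ^+ 2)); last first.
    by move=> t t01; rewrite bump_in01.
  have c0 : (630 : R) != 0 by rewrite pnatr_eq0.
  by rewrite int01_bump mulrAC (divff c0) mul1r.
by move=> t; apply: (cvgM (f := @bump R) (g := @bump R)); exact: continuous_bump.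
Qed.

End edge_form.

(** * Periodicity of the edge error and conclusion *)

Lemma bd_jump_periodic (R : realType) (e s : R) (E : R * R -> R * R -> R) (k : nat) :
  lattice_periodic E -> periodic (bd_jump e s E k).
Proof.
move=> pE [x y].
have U (x' y' : R) : up_bd e s E (x' + 2, y') = up_bd e s E (x', y') /\
    up_bd e s E (x', y' + Num.sqrt 3) = up_bd e s E (x', y').
  have := up_bd_periodic e s x' y' 0 1 pE; have := up_bd_periodic e s x' y' 1 0 pE.
  by rewrite !mul0r !mul1r !addr0.
have D (x' y' : R) : down_bd e s E (x' + 2, y') = down_bd e s E (x', y') /\
    down_bd e s E (x', y' + Num.sqrt 3) = down_bd e s E (x', y').
  have := down_bd_periodic e s x' y' 0 1 pE; have := down_bd_periodic e s x' y' 1 0 pE.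
  by rewrite !mul0r !mul1r !addr0.
case: k => [|[|k]] /=; split.
- by rewrite [x + 2 + e]addrAC (U _ _).1 (D _ _).1.
- by rewrite [y + _ - _]addrAC (U _ _).2 (D _ _).2.
- by rewrite (U _ _).1 (D _ _).1.
- by rewrite (U _ _).2 (D _ _).2.
- by rewrite [x + 2 - _]addrAC (U _ _).1 (D _ _).1.
- by rewrite (U _ _).2 (D _ _).2.
Qed.

Lemma periodic_seg (R : realType) (h : R * R) (psi : form1 R) :
  periodic psi.1 -> periodic psi.2 -> periodic (fun p => seg p h psi).
Proof.
move=> q1 q2 [x y]; split.
  by have := seg_periodic (x, y) h 1 0 q1 q2; rewrite mul1r mul0r -[_ + _]/(x + 2, y + 0) addr0.
by have := seg_periodic (x, y) h 0 1 q1 q2; rewrite mul1r mul0r -[_ + _]/(x + 0, y + _) addr0.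
Qed.

(** In row j the horizontal index 2i + (j mod 2) equals 2 (i - floor(j/2)) + j. *)
Lemma vpos_lattice (R : realType) (n : nat) (v : vertex n) :
  vpos R v = lattice_pt (epsn R n) (Num.sqrt 3) (v.1%:Z - (v.2./2)%:Z) v.2%:Z.
Proof.
case: v => i j; congr pair => /=; last by rewrite -pmulrn mulrA.
rewrite (_ : 2 * _ + _ = ((2 * i + odd j)%N : int)); first by rewrite -pmulrn.
have := odd_double_half j; rewrite -muln2; case: (odd j) => /=; lia.
Qed.

Theorem proposition39 (R : realType) (phi : form1 R) (hphi : form1_C 4 phi) :
  exists C : R, \forall n \near \oo, ~~ odd n ->
    forall sigma : chain1 R n, cycle1 sigma ->
      `| generator (fun s => pairing s phi) sigma - pairing sigma (Lup phi) |
        <= C * (epsn R n * flat_norm (pairing sigma)).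
Proof.
have [C C0 HC] := bd_jump_seg hphi; have [p1 p2 c1 c2] := hphi.
have C2 : form1_C 2 phi by split=> //; exact: (@class_C_le _ 2 4).
have [pL1 pL2 _ _] := form1_C_Lup C2; move: (Lup phi) HC pL1 pL2 => L HC pL1 pL2.
(* 3780 comes from the bound on d psi with D = C e^3; the + 1 ensures the positive factor required
   by [flat_norm_dual]. *)
exists (3780 * (C + 1)); near=> n => en sigma _.
have n2 : (2 < n)%N by near: n; exact: nbhs_infty_gt.
set e := epsn R n; set s : R := Num.sqrt 3.
have n0 : 0 < n%:R :> R by rewrite ltr0n; lia.
have e0 : 0 < e by rewrite invr_gt0.
have ne : n%:R * e = 1 by rewrite mulfV // gt_eqF.
have e1 : e <= 1 by rewrite invf_le1 // ler1n; lia.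
have e0' : e != 0 by rewrite gt_eqF.
(* The error per edge, defined at all points of the plane so that its periodicity can be stated. *)
pose r (k : nat) (p : R * R) : R :=
  - e ^- 2 * (bd_jump e s (fun q h => seg q h phi) k p
              + e ^+ 2 * seg p (dir e s k) L).
have segP (psi : form1 R) : periodic psi.1 -> periodic psi.2 ->
    lattice_periodic (fun q h => seg q h psi).
  by move=> q1 q2 p h a b; rewrite seg_periodic.
have rP k : periodic (r k).
  move=> p; rewrite /r.
  have [-> ->] := bd_jump_periodic e s k (segP _ p1 p2) p.
  by have [-> ->] := periodic_seg (dir e s k) pL1 pL2 p.
have rD k p : `|r k p| <= C * e ^+ 3.
  have i0 : 0 <= e ^- 2 by rewrite invr_ge0 exprn_ge0 // ltW.
  rewrite /r normrM normrN (ger0_norm i0).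
  rewrite ler_pdivrMl ?exprn_gt0 // mulrCA -exprD.
  by apply: HC; exact: ltW.
pose psi := edge_form e r.
have Cpsi : form1_C 1 psi by exact: (edge_form_C1 e0 ne en rP rD).
have -> : generator (fun s => pairing s phi) sigma - pairing sigma L =
    pairing sigma psi.
  rewrite generator_edges // mulr_sumr -sumrB; apply: eq_bigr => -[v k] _.
  rewrite !edge_integralE /src edge_vec_dir [(v, k).1]/= [(v, k).2]/=.
  rewrite [in RHS]vpos_lattice (seg_edge_form r e0) // -vpos_lattice /r -/e -/s.
  by field.
have cpos : 0 < 3780 * (C + 1) * e.
  by apply: mulr_gt0; [apply: mulr_gt0; [rewrite ltr0n|rewrite ltr_wpDl]|exact: e0].
(* The components of [psi] are of order e^2, so e <= 1 already suffices; the rate comes from d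
   psi. *)
have half : 945 * (C * e ^+ 3 / e) <= 3780 * (C + 1) * e / 2.
  have -> : C * e ^+ 3 / e = C * e * e by field.
  have : C * e * e <= C * e by rewrite ler_piMr // mulr_ge0 // ltW.
  have : C * e <= (C + 1) * e by rewrite ler_wpM2r ?(ltW e0) // lerDl.
  have : 0 <= C * e by rewrite mulr_ge0 // ltW.
  rewrite -[3780 * _ * e]mulrA; lra.
rewrite mulrA; apply: flat_norm_dual => //.
- exact: current1_pairing.
- move=> p; have [b _] := edge_form_bound e0 rD p.
  exact: le_trans b half.
- move=> p; have [_ b] := edge_form_bound e0 rD p.
  exact: le_trans b half.
- move=> p; have b := ext_d1_edge_form_bound e0 rD p.
  apply: le_trans b _; rewrite [X in _ * X <= _](_ : _ = C * e); last by field.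
  by rewrite -mulrA; apply: ler_wpM2l; [exact: ler0n|rewrite ler_wpM2r ?(ltW e0) // lerDl].
Unshelve. all: by end_near. Qed.
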